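(* Let $m\ge 1$ be an integer and let $A=\mathbb{Z}\langle x,y\rangle/(x^m)$. For each integer $k\geq 2$ there exists some $l=l(k)\in\mathbb{Z}_{\geq 0}$ such that $\mathrm{Rank}(B_k(A)[l])=\mathrm{Rank}(B_k(A)[j])$ for every $j\geq l$. Furthermore, such an $l$ can be chosen with $l\leq m$ if $k=2$, and with $l\leq 2k+m-5$ if $k\geq 3$.
   Context: $\mathbb{Z}\langle x,y\rangle$ is the free associative unital ring on $x,y$, graded by $\deg x=\deg y=1$; $(x^m)$ is the two-sided ideal generated by $x^m$, and $A$ inherits the grading. For an associative unital algebra $A$, let $[a,b]=ab-ba$, let $L_1(A)=A$ and $L_{k+1}(A)=[A,L_k(A)]$ (the additive span of all $[a,b]$ with $a\in A$, $b\in L_k(A)$), and let $B_k(A)=L_k(A)/L_{k+1}(A)$. These inherit the grading, and $B_k(A)[d]$ denotes the degree $d$ part. $\mathrm{Rank}$ is the rank of a finitely generated abelian group. *)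

(* Defs.v *)
From HB Require Import structures.
From mathcomp Require Import all_boot all_order all_algebra.
From mathcomp Require Import generic_quotient ring_quotient.
From mathcomp Require Import finmap boolp classical_sets.
From mathcomp.multinomials Require Import monalg.

Set Implicit Arguments.
Unset Strict Implicit.
Unset Printing Implicit Defensive.

Import GRing.Theory Num.Theory.
Local Open Scope ring_scope.
Local Open Scope quotient_scope.

Section AdditiveSpan.
Variable V : zmodType.
Implicit Type P : {pred V}.

Definition zspan P : {pred V} := fun v =>
  `[< exists2 s : seq (int * V),
        {in s, forall p, p.2 \in P} & v = \sum_(p <- s) p.2 *~ p.1 >].

Lemma zspan_zmod_closed P : zmod_closed (zspan P).
Proof.
split; first by apply/asboolP; exists [::]; rewrite ?big_nil.
move=> u v /asboolP[s sP ->] /asboolP[t tP ->]; apply/asboolP.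
exists (s ++ [seq (- p.1, p.2) | p <- t]).
  by move=> p; rewrite mem_cat => /orP[/sP//|/mapP[q /tP qP ->]].
rewrite big_cat /= big_map -sumrN; congr (_ + _).
by apply: eq_bigr => p _; rewrite mulrNz.
Qed.

HB.instance Definition _ P :=
  GRing.isZmodClosed.Build V (zspan P) (zspan_zmod_closed P).

Lemma mem_zspan P v : v \in P -> v \in zspan P.
Proof.
move=> vP; apply/asboolP; exists [:: (1, v)]; last by rewrite big_seq1.
by move=> p; rewrite inE => /eqP ->.
Qed.

Lemma zspan_min P (U : zmodClosed V) :
  {subset P <= U} -> {subset zspan P <= U}.
Proof.
move=> sPU v /asboolP[s sP ->]; rewrite big_seq.
by apply: rpred_sum => p ps; rewrite rpredMz // sPU ?sP.
Qed.

End AdditiveSpan.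

(* U / W, formed as the quotient of the subtype U by the trace of W on it;
   it is the usual quotient group when W is included in U. *)
Section SubQuotient.
Variables (V : zmodType) (U W : zmodClosed V).

Definition zsub := {v : V | v \in U}.
HB.instance Definition _ := SubChoice.on zsub.
HB.instance Definition _ := [SubChoice_isSubZmodule of zsub by <:].

Definition ztrace : {pred zsub} := fun u => \val u \in W.

Lemma ztrace_zmod_closed : zmod_closed ztrace.
Proof.
by split=> [|u v uW vW]; rewrite unfold_in /ztrace ?raddf0 ?raddfB ?rpred0 ?rpredB.
Qed.
HB.instance Definition _ :=
  GRing.isZmodClosed.Build zsub ztrace ztrace_zmod_closed.

Definition subquot := Quotient.quot ztrace.
HB.instance Definition _ := ZmodQuotient.on subquot.

End SubQuotient.

Section IdealQuotient.
Variables (R : pzRingType) (g : R).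

Definition gen_ideal : {pred R} := fun f =>
  `[< exists s : seq (R * R), f = \sum_(p <- s) p.1 * g * p.2 >].

Lemma gen_ideal_zmod_closed : zmod_closed gen_ideal.
Proof.
split; first by apply/asboolP; exists [::]; rewrite big_nil.
move=> u v /asboolP[s ->] /asboolP[t ->]; apply/asboolP.
exists (s ++ [seq (- p.1, p.2) | p <- t]).
rewrite big_cat /= big_map -sumrN; congr (_ + _).
by apply: eq_bigr => p _; rewrite !mulNr.
Qed.
HB.instance Definition _ :=
  GRing.isZmodClosed.Build R gen_ideal gen_ideal_zmod_closed.

Lemma gen_idealMl a f : f \in gen_ideal -> a * f \in gen_ideal.
Proof.
move=> /asboolP[s ->]; apply/asboolP; exists [seq (a * p.1, p.2) | p <- s].
by rewrite big_map mulr_sumr; apply: eq_bigr => p _; rewrite !mulrA.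
Qed.

Lemma gen_idealMr a f : f \in gen_ideal -> f * a \in gen_ideal.
Proof.
move=> /asboolP[s ->]; apply/asboolP; exists [seq (p.1, p.2 * a) | p <- s].
by rewrite big_map mulr_suml; apply: eq_bigr => p _; rewrite !mulrA.
Qed.

(* The library only makes quotients by ideals of commutative rings into rings. *)
Definition ideal_quot := Quotient.quot gen_ideal.
HB.instance Definition _ := ZmodQuotient.on ideal_quot.

Definition ideal_proj (f : R) : ideal_quot := \pi_ideal_quot f.

Lemma ideal_proj_zmod_morphism : zmod_morphism ideal_proj.
Proof. by move=> a b; rewrite /ideal_proj raddfB. Qed.
HB.instance Definition _ :=
  GRing.isZmodMorphism.Build R ideal_quot ideal_proj ideal_proj_zmod_morphism.

Lemma ideal_proj_surj a : exists f, ideal_proj f = a.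
Proof. by exists (repr a); rewrite /ideal_proj reprK. Qed.

Lemma ideal_proj_eq0 f : (ideal_proj f == 0) = (f \in gen_ideal).
Proof. by rewrite -(raddf0 ideal_proj) -Quotient.idealrBE subr0. Qed.

Definition ideal_quot_one : ideal_quot := ideal_proj 1.
Definition ideal_quot_mul (a b : ideal_quot) : ideal_quot :=
  ideal_proj (repr a * repr b).

Lemma ideal_quot_mulE (a b : R) :
  ideal_quot_mul (ideal_proj a) (ideal_proj b) = ideal_proj (a * b).
Proof.
apply/eqP; rewrite -Quotient.idealrBE.
set a' := repr _; set b' := repr _.
have ha : a' - a \in gen_ideal by rewrite Quotient.idealrBE reprK.
have hb : b' - b \in gen_ideal by rewrite Quotient.idealrBE reprK.
have -> : a' * b' - a * b = (a' - a) * b' + a * (b' - b).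
  by rewrite mulrBl mulrBr addrA subrK.
by apply: rpredD; [apply: gen_idealMr | apply: gen_idealMl].
Qed.

Fact ideal_quot_mulA : associative ideal_quot_mul.
Proof.
move=> a b c; have [x <-] := ideal_proj_surj a.
have [y <-] := ideal_proj_surj b; have [z <-] := ideal_proj_surj c.
rewrite (ideal_quot_mulE y z) (ideal_quot_mulE x y).
by rewrite (ideal_quot_mulE x (y * z)) (ideal_quot_mulE (x * y) z) mulrA.
Qed.

Fact ideal_quot_mul1 : left_id ideal_quot_one ideal_quot_mul.
Proof.
move=> a; have [x <-] := ideal_proj_surj a.
by rewrite (ideal_quot_mulE 1 x) mul1r.
Qed.

Fact ideal_quot_mulr1 : right_id ideal_quot_one ideal_quot_mul.
Proof.
move=> a; have [x <-] := ideal_proj_surj a.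
by rewrite (ideal_quot_mulE x 1) mulr1.
Qed.

Fact ideal_quot_mulDl : left_distributive ideal_quot_mul +%R.
Proof.
move=> a b c; have [x <-] := ideal_proj_surj a.
have [y <-] := ideal_proj_surj b; have [z <-] := ideal_proj_surj c.
rewrite -(raddfD ideal_proj) (ideal_quot_mulE (x + y) z).
by rewrite (ideal_quot_mulE x z) (ideal_quot_mulE y z) mulrDl raddfD.
Qed.

Fact ideal_quot_mulDr : right_distributive ideal_quot_mul +%R.
Proof.
move=> a b c; have [x <-] := ideal_proj_surj a.
have [y <-] := ideal_proj_surj b; have [z <-] := ideal_proj_surj c.
rewrite -(raddfD ideal_proj) (ideal_quot_mulE x (y + z)).
by rewrite (ideal_quot_mulE x y) (ideal_quot_mulE x z) mulrDr raddfD.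
Qed.

HB.instance Definition _ := GRing.Zmodule_isPzRing.Build ideal_quot
  ideal_quot_mulA ideal_quot_mul1 ideal_quot_mulr1
  ideal_quot_mulDl ideal_quot_mulDr.

Lemma ideal_proj_monoid_morphism : monoid_morphism ideal_proj.
Proof. by split=> [|a b] //; apply/esym/ideal_quot_mulE. Qed.
HB.instance Definition _ :=
  GRing.isMonoidMorphism.Build R ideal_quot ideal_proj ideal_proj_monoid_morphism.

End IdealQuotient.

Section LowerCentralSeries.
Variable A : pzRingType.

Definition ring_comm (a b : A) : A := a * b - b * a.

Fixpoint lcs_rec (n : nat) : {pred A} :=
  if n is n'.+1 then
    zspan (fun c => `[< exists a b, b \in lcs_rec n' /\ c = ring_comm a b >])
  else predT.

(* Indexed from 1, so that [lcs 1] is A; [lcs 0] is a junk value. *)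
Definition lcs (k : nat) : {pred A} := lcs_rec k.-1.

Lemma lcs1 a : a \in lcs 1. Proof. by []. Qed.

Lemma lcs_comm k a b : (0 < k)%N -> b \in lcs k -> ring_comm a b \in lcs k.+1.
Proof.
case: k => // k _ bk; rewrite /lcs /=; apply: mem_zspan.
by apply/asboolP; exists a, b.
Qed.

Lemma lcs_zmod_closed k : zmod_closed (lcs k).
Proof. by rewrite /lcs; case: k.-1 => // n; apply: zspan_zmod_closed. Qed.
HB.instance Definition _ k := GRing.isZmodClosed.Build A (lcs k) (lcs_zmod_closed k).

Lemma lcsS k : {subset lcs k.+1 <= lcs k}.
Proof.
case: k => [|k]; first by [].
elim: k => [|k IHk] //; apply: zspan_min => c /asboolP[a [b [bk ->]]].
by apply: lcs_comm => //; apply: IHk.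
Qed.

Definition lcs_quot (k : nat) := subquot (lcs k) (lcs k.+1).
HB.instance Definition _ k := ZmodQuotient.on (lcs_quot k).

End LowerCentralSeries.
Arguments lcs A k : clear implicits.

Section Rank.
Variable V : zmodType.

Definition zfree n (v : 'I_n -> V) : Prop :=
  forall c : 'I_n -> int, \sum_i v i *~ c i = 0 -> forall i, c i = 0.

Definition is_rank (S : {pred V}) (r : nat) : Prop :=
  (exists2 v : 'I_r -> V, (forall i, v i \in S) & zfree v) /\
  (forall n (v : 'I_n -> V), (forall i, v i \in S) -> zfree v -> (n <= r)%N).

(* 0 when the size of the independent families of S is not bounded. *)
Definition rank (S : {pred V}) : nat := xget 0%N [set r | is_rank S r]%classic.

Lemma is_rank_uniq S r r' : is_rank S r -> is_rank S r' -> r = r'.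
Proof.
move=> [[v vS fv] mr] [[v' v'S fv'] mr'].
by apply/eqP; rewrite eqn_leq (mr' _ v) ?(mr _ v').
Qed.

Lemma rankE S r : is_rank S r -> rank S = r.
Proof. by move=> Sr; apply: xget_unique => // r' /is_rank_uniq/(_ Sr). Qed.

Lemma rankP S N :
    (forall n (v : 'I_n -> V), (forall i, v i \in S) -> zfree v -> (n <= N)%N) ->
  is_rank S (rank S).
Proof.
move=> SN; pose P n := `[< exists2 v : 'I_n -> V, (forall i, v i \in S) & zfree v >].
have exP : exists n, P n.
  by exists 0%N; apply/asboolP; exists (fun=> 0) => [[]|? ? []].
have maxP n : P n -> (n <= N)%N by move=> /asboolP[v]; apply: SN.
case: (ex_maxnP exP maxP) => r /asboolP Sr maxr.
have Rr : is_rank S r.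
  by split=> // n v vS fv; apply: maxr; apply/asboolP; exists v.
by rewrite (rankE Rr).
Qed.

End Rank.

Lemma int_mx_dep n p (M : 'M[int]_(n, p)) :
  (p < n)%N -> exists2 c : 'rV[int]_n, c != 0 & c *m M = 0.
Proof.
move=> ltpn; pose MQ := map_mx (intr : int -> rat) M.
have /rowV0Pn[u /sub_kermxP uM u0] : kermx MQ != 0.
  rewrite -mxrank_eq0 mxrank_ker -lt0n subn_gt0.
  exact: leq_ltn_trans (rank_leq_col _) ltpn.
pose d : int := \prod_j denq (u 0 j).
have d0 : d != 0 by apply/prodf_neq0 => j _; rewrite denq_eq0.
pose c : 'rV[int]_n := \row_i (numq (u 0 i) * \prod_(j | j != i) denq (u 0 j)).
have cE : map_mx (intr : int -> rat) c = d%:~R *: u.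
  apply/rowP => i; rewrite !mxE /d [in RHS](bigD1 i) //= !intrM numqE.
  by rewrite [RHS]mulrC mulrA.
exists c.
  apply: contraNneq u0 => c0; move: cE; rewrite c0 map_mx0 => /esym/eqP.
  by rewrite scaler_eq0 intr_eq0 (negPf d0).
apply/matrixP=> i j; apply: (intr_inj (R := rat)).
have : map_mx (intr : int -> rat) (c *m M) = 0.
  by rewrite map_mxM cE -scalemxAl uM scaler0.
by move/matrixP/(_ i j); rewrite [in RHS]mxE mxE => ->; rewrite mxE.
Qed.

Section TruncatedAlgebra.
Variable m : nat.

Definition freeZxy := {malg int[{fmonom 'I_2}]}.
Definition var_x : freeZxy := << fmu (0 : 'I_2) >>.
Definition var_y : freeZxy := << fmu (1 : 'I_2) >>.

(* Z<x,y>/(x^m) *)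
Definition Zxy_xm := ideal_quot (var_x ^+ m).
HB.instance Definition _ := GRing.PzRing.on Zxy_xm.

Definition homog (d : nat) : {pred freeZxy} :=
  fun f => `[< forall w, w \in msupp f -> fdeg w = d >].

Lemma homog_zmod_closed d : zmod_closed (homog d).
Proof.
split=> [|f g /asboolP fd /asboolP gd]; apply/asboolP => w.
  by rewrite msupp0 inE.
by move/(fsubsetP (msuppB_le f g)); rewrite inE => /orP[/fd|/gd].
Qed.
HB.instance Definition _ d :=
  GRing.isZmodClosed.Build freeZxy (homog d) (homog_zmod_closed d).

Definition Zxy_xm_deg (d : nat) : {pred Zxy_xm} :=
  fun a => `[< exists2 f, f \in homog d & a = ideal_proj (var_x ^+ m) f >].

Lemma Zxy_xm_deg_zmod_closed d : zmod_closed (Zxy_xm_deg d).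
Proof.
split=> [|a b /asboolP[f fd ->] /asboolP[g gd ->]]; apply/asboolP.
  by exists 0; rewrite ?rpred0 ?raddf0.
by exists (f - g); rewrite ?rpredB ?raddfB.
Qed.
HB.instance Definition _ d :=
  GRing.isZmodClosed.Build Zxy_xm (Zxy_xm_deg d) (Zxy_xm_deg_zmod_closed d).

Definition B (k : nat) := lcs_quot Zxy_xm k.
HB.instance Definition _ k := ZmodQuotient.on (B k).

Definition B_deg (k d : nat) : {pred B k} :=
  fun b => `[< exists2 u : zsub (lcs Zxy_xm k),
                 \val u \in Zxy_xm_deg d & b = \pi_(B k) u >].

Arguments B_deg : clear implicits.

Lemma B_deg_zmod_closed k d : zmod_closed (B_deg k d).
Proof.
split=> [|a b /asboolP[u ud ->] /asboolP[v vd ->]]; apply/asboolP.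
  by exists 0; rewrite ?raddf0 ?rpred0.
by exists (u - v); rewrite ?raddfB ?rpredB.
Qed.
HB.instance Definition _ k d :=
  GRing.isZmodClosed.Build (B k) (B_deg k d) (B_deg_zmod_closed k d).

Lemma B_deg_rank k d : is_rank (B_deg k d) (rank (B_deg k d)).
Proof.
pose T := d.-tuple 'I_2.
apply: (@rankP _ _ #|{: T}|) => n v vB fv.
rewrite leqNgt; apply/negP => ltTn.
have /choice[u uP] : forall i, exists u : zsub (lcs Zxy_xm k),
    \val u \in Zxy_xm_deg d /\ v i = \pi_(B k) u.
  by move=> i; have /asboolP[u ud vu] := vB i; exists u.
have /choice[f fP] : forall i, exists f,
    f \in homog d /\ \val (u i) = ideal_proj (var_x ^+ m) f.
  by move=> i; have [/asboolP[f fd uf] _] := uP i; exists f.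
pose M : 'M[int]_(n, #|{: T}|) :=
  \matrix_(i, j) (f i)@_(FMonom (enum_val j : T)).
have [c c0 cM] := int_mx_dep M ltTn.
have fc0 : \sum_i f i *~ c 0 i = 0.
  apply/malgP => -[w]; rewrite raddf_sum mcoeff0 /=.
  have [wd|wd] := eqVneq (size w) d; last first.
    apply: big1 => i _; rewrite raddfMz /= mcoeff_outdom ?mul0rz //.
    apply/negP => wf; have [/asboolP/(_ _ wf) e _] := fP i.
    by move: wd; rewrite -e fdegE eqxx.
  have wt : size w == d by apply/eqP.
  have /matrixP/(_ 0 (enum_rank (Tuple wt))) := cM.
  rewrite !mxE => E; apply: etrans E; apply: eq_bigr => i _.
  by rewrite raddfMz /= !mxE enum_rankK /= mulrzz mulrC.
have uc0 : \sum_i u i *~ c 0 i = 0.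
  apply/val_inj; rewrite raddf_sum raddf0 /=.
  have := congr1 (ideal_proj (var_x ^+ m)) fc0.
  rewrite raddf0 raddf_sum => E; apply: etrans E.
  apply: eq_bigr => i _; rewrite -[LHS]/(\val (u i *~ c 0 i)).
  by rewrite [LHS]raddfMz [RHS]raddfMz; congr (_ *~ _); apply: (fP i).2.
have /fv vc0 : \sum_i v i *~ c 0 i = 0.
  have := congr1 (\pi_(B k)) uc0.
  rewrite raddf0 raddf_sum => E; apply: etrans E.
  by apply: eq_bigr => i _; rewrite raddfMz (uP i).2.
by move: c0; rewrite (_ : c = 0) ?eqxx //; apply/rowP => i; rewrite vc0 mxE.
Qed.

End TruncatedAlgebra.
Arguments B_deg : clear implicits.

(* Main.v *)
Require Import Defs.
From HB Require Import structures.
From mathcomp Require Import all_boot all_order all_algebra.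
From mathcomp Require Import generic_quotient ring_quotient.
From mathcomp Require Import finmap boolp ring zify.
From mathcomp.multinomials Require Import monalg.
From Stdlib Require Ncring Ncring_tac.

(** Let L_k be the terms of the lower central series of A, N_k their rational
    saturations, and f the derivation of A with f x = 0 and f y = y^2. It
    raises degrees by one and acts on every B_k(A). For k >= 2 the ranks
    of the homogeneous parts become constant because f is injective up to
    torsion on B_k in every degree (f_inj), and surjective up to torsion onto
    degree d + 1 as soon as d >= m if k = 2, or d >= 2k + m - 5 if k >= 3
    (f_surj). So the least such d can be taken for l.

    Injectivity is representation theory of sl_2. Let e and E be the derivations
    that kill x and send y to 1 and to y. Then [e, f] = 2E, [E, f] = f and
    [E, e] = -e. The weights of E on A are nonnegative, and positive on L_2
    since the powers of x commute. An element of weight b > 0 that is killed by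
    f modulo N_(k+1) would start a string of vectors e^j u of weights b - j with
    f (e^(j+1) u) a nonzero multiple of e^j u for j <= b; as the weight -1 does
    not occur, the string vanishes, and so does u.

    Surjectivity rests on a description of B_k by polynomials. As A has two
    generators, [a[b, c], e] lies in N_3 (q_eq0), and it follows that the
    elements of the ideal generated by commutators move L_j into N_(j+2) by
    bracketing (deg2_lcs). With n = k - 1, the commutators
    [a_0, [a_1, ... a_n]] modulo N_(n+2) thus only depend on the classes of
    the a_i in a commutative ring, and they define a map T from polynomials in
    n + 1 pairs of variables, the coordinates of n + 1 points of the plane, onto
    L_(n+1) modulo N_(n+2) (T_surj). This map is local: it kills every product of
    three differences of coordinates between the same two adjacent points, and
    of two differences between the last two points (local3, local2), because
    of the identities 6 [a^2, [a^2, w]] - 4 [a^3, [a, w]] - 4 [a, [a^3, w]]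
    = -2 [a, [a, [a, [a, w]]]] and [ab, c] + [bc, a] + [ca, b] = 0. Consequently
    2n differences are always killed (order_Tker).

    On polynomials, f becomes the derivation slotD with y_i -> y_i^2. Write a
    polynomial in the coordinates x_1, y_1 of the first point and the
    differences. Up to terms with more differences, slotD multiplies a monomial
    by a multiple of y_1 (slotD_word), so that a monomial divisible by y_1 is a
    derivative. A monomial of large degree without y_1 contains x_1^(m-1), and
    the relation x^m = 0 at adjacent points lets a difference of x times
    x_1^(m-1) be expressed with more differences (word_rel). The remaining
    monomials give commutators of powers of one generator. Descending induction
    on the number of differences concludes (wspan_good). *)

Set Implicit Arguments.
Unset Strict Implicit.
Unset Printing Implicit Defensive.

Import GRing.Theory.
Local Open Scope ring_scope.
Local Open Scope quotient_scope.

Local Notation "⟦ a , b ⟧" := (ring_comm a b).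

(** * Identities in noncommutative rings *)
Section NoncommutativeRing.
Variable A : pzRingType.

Instance ncring_ops :
  @Ncring.Ring_ops A 0 1 +%R *%R (fun a b => a - b) -%R eq := {}.

Instance ncring_ring : @Ncring.Ring A _ _ _ _ _ _ _ ncring_ops.
Proof.
constructor.
- exact: RelationClasses.eq_equivalence.
- by move=> ? ? -> ? ? ->.
- by move=> ? ? -> ? ? ->.
- by move=> ? ? -> ? ? ->.
- by move=> ? ? ->.
- exact: add0r.
- exact: addrC.
- exact: addrA.
- exact: mul1r.
- exact: mulr1.
- exact: mulrA.
- exact: mulrDl.
- by move=> x y z; apply: mulrDr.
- by [].
- exact: addrN.
Qed.

End NoncommutativeRing.

Ltac ncring :=
  rewrite /ring_comm ?exprS ?expr0 ?mulrS ?mulr0n;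
  Ncring_tac.non_commutative_ring.
#[local] Existing Instance ncring_ops.
#[local] Existing Instance ncring_ring.

(** * Integral spans and rational saturation *)
Section Span.
Variable V : zmodType.

Lemma zspan_ind (P : {pred V}) (Q : V -> Prop) :
    Q 0 -> (forall a b, Q a -> Q b -> Q (a - b)) -> (forall a, a \in P -> Q a) ->
  forall a, a \in zspan P -> Q a.
Proof.
move=> Q0 QB QP.
have QD a b : Q a -> Q b -> Q (a + b).
  by move=> Qa Qb; rewrite -[b]opprK -[- b]sub0r; do 2!apply: (QB) => //.
have QMn a n : Q a -> Q (a *+ n).
  by move=> Qa; elim: n => // n IHn; rewrite mulrS; apply: QD.
move=> a /asboolP[s sP ->]; elim: s sP => [|p s IHs] sP; rewrite ?big_nil //.
rewrite big_cons; apply: QD; last first.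
  by apply: IHs => q qs; apply: sP; rewrite inE qs orbT.
have Qp : Q p.2 by apply/QP/sP; rewrite inE eqxx.
case: (p.1) => n; first by rewrite -pmulrn; apply: QMn.
by rewrite NegzE mulrNz -pmulrn -sub0r; apply: QB => //; apply: QMn.
Qed.

(** Ranks do not see the difference between a subgroup and its rational
    saturation, and in the latter nonzero integers can be divided out. *)
Definition sat (P : {pred V}) : {pred V} := fun a =>
  `[< exists2 n : nat, (0 < n)%N & a *+ n \in P >].

Lemma mem_satP (P : {pred V}) a :
  reflect (exists2 n : nat, (0 < n)%N & a *+ n \in P) (a \in sat P).
Proof. exact: asboolP. Qed.

Lemma sat_zmod_closed (U : zmodClosed V) : zmod_closed (sat U).
Proof.
split=> [|a b /mem_satP[n n0 aU] /mem_satP[p p0 bU]]; apply/mem_satP.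
  by exists 1%N; rewrite // mulr1n rpred0.
exists (n * p)%N; first by rewrite muln_gt0 n0.
by rewrite mulrnBl {2}mulnC !mulrnA; apply: rpredB; apply: rpredMn.
Qed.
HB.instance Definition _ (U : zmodClosed V) :=
  GRing.isZmodClosed.Build V (sat U) (sat_zmod_closed U).

Lemma mem_sat (P : {pred V}) a : a \in P -> a \in sat P.
Proof. by move=> aP; apply/mem_satP; exists 1%N. Qed.

Lemma sat_divn (P : {pred V}) a n : (0 < n)%N -> a *+ n \in sat P -> a \in sat P.
Proof.
move=> n0 /mem_satP[p p0 aP]; apply/mem_satP; exists (n * p)%N; last by rewrite mulrnA.
by rewrite muln_gt0 n0.
Qed.

Lemma sat_divz (U : zmodClosed V) a (n : int) :
  n != 0 -> a *~ n \in sat U -> a \in sat U.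
Proof.
case: n => n n0; first by rewrite -pmulrn; apply: sat_divn; case: n n0.
by rewrite NegzE mulrNz rpredN -pmulrn; apply: sat_divn.
Qed.

End Span.

Lemma zspanM (R : pzRingType) (P Q U : {pred R}) :
    (forall a b, a \in P -> b \in Q -> a * b \in zspan U) ->
  forall a b, a \in zspan P -> b \in zspan Q -> a * b \in zspan U.
Proof.
move=> PQ a b aP bQ; move: a aP b bQ; apply: zspan_ind => [b _|a a' ha ha' b bQ|a aP].
- by rewrite mul0r rpred0.
- by rewrite mulrBl rpredB ?ha ?ha'.
apply: zspan_ind => [|b b' hb hb'|b bQ]; first by rewrite mulr0 rpred0.
  by rewrite mulrBr rpredB.
exact: PQ.
Qed.

(** * The lower central series and derivations *)
Section Commutators.
Variable A : pzRingType.
Implicit Types a b c d : A.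

Lemma ring_commBl a b c : ⟦a - b, c⟧ = ⟦a, c⟧ - ⟦b, c⟧.
Proof. by ncring. Qed.
Lemma ring_commBr a b c : ⟦a, b - c⟧ = ⟦a, b⟧ - ⟦a, c⟧.
Proof. by ncring. Qed.
Lemma ring_commDl a b c : ⟦a + b, c⟧ = ⟦a, c⟧ + ⟦b, c⟧.
Proof. by ncring. Qed.
Lemma ring_comm0r a : ⟦a, 0⟧ = 0. Proof. by rewrite /ring_comm mulr0 mul0r subrr. Qed.
Lemma ring_comm0l a : ⟦0, a⟧ = 0. Proof. by rewrite /ring_comm mulr0 mul0r subrr. Qed.
Lemma ring_comm1l a : ⟦1, a⟧ = 0. Proof. by rewrite /ring_comm mulr1 mul1r subrr. Qed.
Lemma ring_commMnl a b n : ⟦a *+ n, b⟧ = ⟦a, b⟧ *+ n.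
Proof. by rewrite /ring_comm mulrnAl mulrnAr mulrnBl. Qed.
Lemma ring_commMnr a b n : ⟦a, b *+ n⟧ = ⟦a, b⟧ *+ n.
Proof. by rewrite /ring_comm mulrnAl mulrnAr mulrnBl. Qed.
Lemma ring_commC a b : ⟦a, b⟧ = - ⟦b, a⟧.
Proof. by rewrite /ring_comm opprB. Qed.
Lemma ring_commMzl a b n : ⟦a *~ n, b⟧ = ⟦a, b⟧ *~ n.
Proof. by rewrite /ring_comm mulrzAl mulrzAr mulrzBl. Qed.
Lemma ring_commMzr a b n : ⟦a, b *~ n⟧ = ⟦a, b⟧ *~ n.
Proof. by rewrite /ring_comm mulrzAl mulrzAr mulrzBl. Qed.
HB.instance Definition _ a :=
  GRing.isZmodMorphism.Build A A (ring_comm a) (fun b c => ring_commBr a b c).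

Lemma lcs_ind k (Q : A -> Prop) : (0 < k)%N ->
    Q 0 -> (forall a b, Q a -> Q b -> Q (a - b)) ->
    (forall a b, b \in lcs A k -> Q ⟦a, b⟧) ->
  forall c, c \in lcs A k.+1 -> Q c.
Proof.
case: k => // k _ Q0 QB QP c cL; apply: (zspan_ind Q0 QB _ cL) => {c cL}.
by move=> c /asboolP[a [b [bL ->]]]; apply: QP.
Qed.

Lemma lcs_le i j : (i <= j)%N -> {subset lcs A j <= lcs A i}.
Proof.
move=> /subnK<-; elim: (j - i)%N => // n IHn c cL; apply: IHn.
by rewrite addSn in cL; apply: lcsS.
Qed.

(** Induction on i: the Jacobi identity moves one factor of a over to b. *)
Lemma lcs_commD i j a b : (0 < i)%N -> (0 < j)%N ->
  a \in lcs A i -> b \in lcs A j -> ⟦a, b⟧ \in lcs A (i + j).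
Proof.
case: i => // i _; elim: i j a b => [|i IHi] j a b j0 aL bL.
  by rewrite add1n; apply: lcs_comm.
move: a aL b bL; apply: lcs_ind => // [b bL|a1 a2 IH1 IH2 b bL|p a aL b bL].
- by rewrite ring_comm0l rpred0.
- by rewrite ring_commBl rpredB ?IH1 ?IH2.
have -> : ⟦ ⟦p, a⟧, b⟧ = ⟦p, ⟦a, b⟧⟧ - ⟦a, ⟦p, b⟧⟧ by ncring.
rewrite addSn; apply: rpredB; first by apply: lcs_comm; rewrite ?addSn ?IHi.
by rewrite -addnS; apply: IHi => //; apply: lcs_comm.
Qed.

Definition slcs k : {pred A} := sat (lcs A k).
HB.instance Definition _ k := GRing.ZmodClosed.on (slcs k).

Lemma mem_slcs k a : a \in lcs A k -> a \in slcs k.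
Proof. exact: mem_sat. Qed.

Lemma slcs_commD i j a b : (0 < i)%N -> (0 < j)%N ->
  a \in slcs i -> b \in slcs j -> ⟦a, b⟧ \in slcs (i + j).
Proof.
move=> i0 j0 /mem_satP[n n0 aL] /mem_satP[p p0 bL]; apply/mem_satP; exists (n * p)%N.
  by rewrite muln_gt0 n0.
by rewrite mulrnA -ring_commMnl -ring_commMnr; apply: lcs_commD.
Qed.

Lemma slcs_comm k a b : (0 < k)%N -> b \in slcs k -> ⟦a, b⟧ \in slcs k.+1.
Proof. by move=> k0; rewrite -add1n; apply: slcs_commD => //; apply: mem_slcs. Qed.

End Commutators.
Arguments slcs A k : clear implicits.

Definition derivation (A : pzRingType) (D : A -> A) :=
  forall a b, D (a * b) = D a * b + a * D b.

Section DerivationTheory.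
Variables (A : pzRingType) (D : {additive A -> A}).
Hypothesis DM : derivation D.

Lemma derivation1 : D 1 = 0.
Proof. by have /eqP := DM 1 1; rewrite !mulr1 mul1r -subr_eq subrr eq_sym => /eqP. Qed.

Lemma derivation_comm a b : D ⟦a, b⟧ = ⟦D a, b⟧ + ⟦a, D b⟧.
Proof. by rewrite /ring_comm (raddfB D) /= !DM; ncring. Qed.

Lemma derivation_lcs k a : a \in lcs A k -> D a \in lcs A k.
Proof.
case: k => [|k] //; elim: k a => [|k IHk] //.
apply: lcs_ind => // [|a b ha hb|a b bL]; first by rewrite raddf0 rpred0.
  by rewrite raddfB rpredB.
by rewrite derivation_comm rpredD //; apply: lcs_comm => //; apply: IHk.
Qed.

Lemma derivation_slcs k a : a \in slcs A k -> D a \in slcs A k.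
Proof.
by move=> /mem_satP[n n0 aL]; apply/mem_satP; exists n; rewrite // -raddfMn derivation_lcs.
Qed.

Lemma derivationX0 a j : D a = 0 -> D (a ^+ j) = 0.
Proof.
move=> Da; elim: j => [|j IHj]; first by rewrite expr0 derivation1.
by rewrite exprS DM Da IHj mul0r mulr0 addr0.
Qed.

Lemma derivationX_fix a j : D a = a -> D (a ^+ j) = a ^+ j *+ j.
Proof.
move=> Da; elim: j => [|j IHj]; first by rewrite expr0 derivation1 mulr0n.
by rewrite exprS DM IHj Da mulrnAr -mulrS.
Qed.

End DerivationTheory.

(** * Brackets in a ring with two generators *)

(** Generation by x and y, as the induction principle that it provides. *)
Definition generated (A : pzRingType) (x y : A) := forall Q : A -> Prop,
  Q 1 -> Q x -> Q y -> (forall a b, Q a -> Q b -> Q (a - b)) ->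
  (forall a b, Q a -> Q b -> Q (a * b)) -> forall a, Q a.

Section TwoGenerators.
Variables (A : pzRingType) (x y : A).
Hypothesis gen : generated x y.
Local Notation N := (slcs A).
Local Notation q a b c e := (@ring_comm A (a * @ring_comm A b c) e).

Lemma q_swap14 a b c e : q a b c e + q e b c a \in N 3.
Proof.
have -> : q a b c e + q e b c a = - ⟦e * a, ⟦b, c⟧⟧ - ⟦⟦ ⟦b, c⟧, e⟧, a⟧.
  by ncring.
apply/mem_slcs/rpredB; rewrite ?rpredN; first by do 2!apply: lcs_comm => //.
rewrite ring_commC rpredN; apply: lcs_comm => //.
apply: (@lcsS _ 2); rewrite ring_commC rpredN; apply: lcs_comm => //.
exact: lcs_comm.
Qed.

Lemma q_swap12 a b c e : q a b c e + q b a c e \in N 3.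
Proof.
have -> : q a b c e + q b a c e = - ⟦e, ⟦a * b, c⟧ + ⟦b, ⟦a, c⟧⟧⟧ by ncring.
apply/mem_slcs; rewrite rpredN; apply: lcs_comm => //.
by apply: rpredD; first exact: lcs_comm; apply: (@lcsS _ 2); do 2!apply: lcs_comm => //.
Qed.

Lemma q_swap23 a b c e : q a c b e = - q a b c e.
Proof. by ncring. Qed.

Lemma q_mul a b c d e : q a b (c * d) e - q (d * a) b c e - q (a * c) b d e \in N 3.
Proof.
have -> : q a b (c * d) e - q (d * a) b c e - q (a * c) b d e =
  - ⟦e, ⟦a * ⟦b, c⟧, d⟧⟧ by ncring.
by apply/mem_slcs; rewrite rpredN; do 2!apply: lcs_comm => //.
Qed.

Lemma q_gen b e : (forall a, q a b x e \in N 3) -> (forall a, q a b y e \in N 3) ->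
  forall c a, q a b c e \in N 3.
Proof.
move=> qx qy; apply: gen => // [a|c d qc qd a|c d qc qd a].
- by have -> : q a b 1 e = 0; [ncring|rewrite rpred0].
- have -> : q a b (c - d) e = q a b c e - q a b d e by ncring.
  by rewrite rpredB ?qc ?qd.
have := q_mul a b c d e.
by rewrite rpredBr ?qd // rpredBr ?qc.
Qed.

(** Modulo N 3 the form q, where q a b c e is [a[b, c], e], changes sign under
    the swaps 14, 12 and 23, hence is alternating in its four arguments, and by
    q_mul an argument that is a product can be replaced by its factors. So it
    is determined by its values on generators; as there are only two of them,
    two of the four arguments then coincide. *)
Lemma q_eq0 a b c e : q a b c e \in N 3.
Proof.
have q14 a' b' c' e' : (q a' b' c' e' \in N 3) = (q e' b' c' a' \in N 3).
  apply/idP/idP => h; first by have := q_swap14 a' b' c' e'; rewrite rpredDl.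
  by have := q_swap14 a' b' c' e'; rewrite rpredDr.
have q12 a' b' c' e' : (q a' b' c' e' \in N 3) = (q b' a' c' e' \in N 3).
  apply/idP/idP => h; first by have := q_swap12 a' b' c' e'; rewrite rpredDl.
  by have := q_swap12 a' b' c' e'; rewrite rpredDr.
have q23 a' b' c' e' : (q a' b' c' e' \in N 3) = (q a' c' b' e' \in N 3).
  by rewrite (q_swap23 a' c') rpredN.
have qd a' b' e' : q a' b' b' e' \in N 3.
  by rewrite (_ : q _ _ _ _ = 0) ?rpred0 //; ncring.
have q13 a' b' c' e' : (q a' b' c' e' \in N 3) = (q c' b' a' e' \in N 3).
  by rewrite q23 q12 q23.
have q34 a' b' c' e' : (q a' b' c' e' \in N 3) = (q a' b' e' c' \in N 3).
  by rewrite q14 q13 q14.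
have q24 a' b' c' e' : (q a' b' c' e' \in N 3) = (q a' e' c' b' \in N 3).
  by rewrite q23 q34 q23.
have qd12 a' c' e' : q a' a' c' e' \in N 3 by rewrite q13 qd.
have qd24 a' b' c' : q a' b' c' b' \in N 3 by rewrite q34.
have qd34 a' b' c' : q a' b' c' c' \in N 3 by rewrite q24.
pose xy z := z = x \/ z = y.
have [xyx xyy] : xy x /\ xy y by split; [left|right].
have two b' e' : xy b' -> xy e' -> forall c' a', q a' b' c' e' \in N 3.
  by move=> [] -> [] ->; apply: q_gen.
have one b' : xy b' -> forall a' c' e', q a' b' c' e' \in N 3.
  move=> xyb a' c' e'; rewrite q13 q34 q13; apply: q_gen => d;
    by rewrite q34; apply: two.
by rewrite q23; apply: q_gen => d; rewrite q23; apply: one.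
Qed.

(** Such elements act with degree two: a bracket with one of them
    moves an element two steps down the series (deg2_lcs), where a bracket in
    general moves it by one step. Brackets in the graded quotients therefore
    depend on their entries only modulo deg2, which contains all commutators
    by deg2_comm: they see a commutative ring. *)
Definition deg2 (z : A) : Prop := forall c d e, ⟦c * z * d, e⟧ \in N 3.

Lemma deg2B z z' : deg2 z -> deg2 z' -> deg2 (z - z').
Proof.
move=> hz hz' c d e.
by rewrite mulrBr mulrBl ring_commBl rpredB.
Qed.
Lemma deg2_0 : deg2 0.
Proof. by move=> c d e; rewrite mulr0 mul0r ring_comm0l rpred0. Qed.
Lemma deg2D z z' : deg2 z -> deg2 z' -> deg2 (z + z').
Proof.
move=> hz hz' c d e.
by rewrite mulrDr mulrDl ring_commDl rpredD.
Qed.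
Lemma deg2M c z d : deg2 z -> deg2 (c * z * d).
Proof. by move=> hz p r e; have := hz (p * c) (d * r) e; rewrite !mulrA. Qed.
Lemma deg2Ml c z : deg2 z -> deg2 (c * z).
Proof. by move=> hz; rewrite -[_ * z]mulr1; apply: deg2M. Qed.
Lemma deg2Mr z d : deg2 z -> deg2 (z * d).
Proof. by move=> hz; rewrite -[z]mul1r; apply: deg2M. Qed.

(** Bringing d to the front of p [b, c] d costs a commutator, whose brackets
    are in L_3 anyway; what remains is q_eq0. *)
Lemma deg2_comm b c : deg2 ⟦b, c⟧.
Proof.
move=> p d e.
have -> : p * ⟦b, c⟧ * d = d * p * ⟦b, c⟧ - ⟦d, p * ⟦b, c⟧⟧ by ncring.
rewrite ring_commBl rpredB ?q_eq0 // ring_commC rpredN; apply: mem_slcs.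
by do 2!apply: lcs_comm => //.
Qed.

Lemma deg2_lcs k z w : (0 < k)%N -> deg2 z -> w \in N k -> ⟦z, w⟧ \in N k.+2.
Proof.
move=> k0 hz /mem_satP[n n0 wL]; apply: (sat_divn n0); rewrite -ring_commMnr.
case: k k0 wL => // k _; elim: k {w n n0} (w *+ n) => [v _|k IHk].
  by have := hz 1 1 v; rewrite mul1r mulr1.
apply: lcs_ind => // [|a b ha hb|a b bL]; first by rewrite ring_comm0r rpred0.
  by rewrite ring_commBr rpredB.
have -> : ⟦z, ⟦a, b⟧⟧ = ⟦ ⟦z, a⟧, b⟧ + ⟦a, ⟦z, b⟧⟧ by ncring.
apply: rpredD; last by apply: slcs_comm => //; apply: IHk.
rewrite -[k.+4]/(3 + k.+1)%N; apply: slcs_commD => //; last exact: mem_slcs.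
by have := hz 1 1 a; rewrite mul1r mulr1.
Qed.

End TwoGenerators.

(** * Iterated polynomial rings *)

(** The outer variable stands for x and the inner one for y. *)
Definition pol2 (R : comNzRingType) : comNzRingType := {poly {poly R}}.

Section BivariatePolynomials.
Variable R : comNzRingType.

Definition pX : pol2 R := 'X.
Definition pY : pol2 R := 'X%:P.
Definition emb (c : R) : pol2 R := c%:P%:P.

Fact emb_is_zmod : zmod_morphism emb.
Proof. by move=> a b; rewrite /emb !raddfB. Qed.
Fact emb_is_monoid : monoid_morphism emb.
Proof. by split=> [|a b]; rewrite /emb ?rmorph1 ?rmorphM. Qed.
HB.instance Definition _ := GRing.isZmodMorphism.Build R (pol2 R) emb emb_is_zmod.
HB.instance Definition _ :=
  GRing.isMonoidMorphism.Build R (pol2 R) emb emb_is_monoid.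

Definition pmon (i j : nat) (c : R) : pol2 R := pX ^+ i * pY ^+ j * emb c.

Lemma pmonE i j c : pmon i j c = (c%:P * 'X^j)%:P * 'X^i.
Proof.
by rewrite /pmon /pX /pY /emb -mulrA mulrC -rmorphXn -rmorphM /= (mulrC 'X^j).
Qed.

Lemma pmonM i j c i' j' c' :
  pmon i j c * pmon i' j' c' = pmon (i + i') (j + j') (c * c').
Proof. by rewrite /pmon !exprD rmorphM; ring. Qed.

Lemma pmonB i j a b : pmon i j (a - b) = pmon i j a - pmon i j b.
Proof. by rewrite /pmon raddfB mulrBr. Qed.

Lemma pol2_ind (Q : pol2 R -> Prop) :
    Q 0 -> (forall a b, Q a -> Q b -> Q (a - b)) -> (forall i j c, Q (pmon i j c)) ->
  forall g, Q g.
Proof.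
move=> Q0 QB Qm.
have QD a b : Q a -> Q b -> Q (a + b).
  by move=> Qa Qb; rewrite -[b]opprK -[- b]sub0r; do 2!apply: (QB) => //.
have Qs (I : Type) (r : seq I) F : (forall i, Q (F i)) -> Q (\sum_(i <- r) F i).
  by move=> QF; elim: r => [|i r IH]; rewrite ?big_nil ?big_cons //; apply: QD.
move=> g; rewrite -[g]coefK poly_def; apply: (Qs) => i.
rewrite -[g`_i]coefK poly_def scaler_suml; apply: Qs => j.
by rewrite -mul_polyC -mul_polyC -pmonE.
Qed.

Section Extension.
Variables (V : zmodType) (phi : nat -> nat -> R -> V).
Hypothesis phiB : forall i j a b, phi i j (a - b) = phi i j a - phi i j b.

(** V need not be an R-module, so the coefficient is an argument of phi. *)
Definition pext (g : {poly {poly R}}) : V :=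
  \sum_(i < size g) \sum_(j < size g`_i) phi i j g`_i`_j.

Let phi0 i j : phi i j 0 = 0.
Proof. by rewrite -[in LHS](subrr 0) phiB subrr. Qed.

Lemma pext_wide n (g : {poly {poly R}}) :
    (size g <= n)%N -> (forall i, size (g`_i)%R <= n)%N ->
  pext g = \sum_(i < n) \sum_(j < n) phi i j g`_i`_j.
Proof.
move=> gn gin; rewrite /pext (big_ord_widen _ (fun i => \sum_(j < size g`_i) phi i j g`_i`_j) gn).
rewrite big_mkcond; apply: eq_bigr => i _.
have [ig|gi] := ltnP; last first.
  by rewrite big1 // => j _; rewrite (nth_default 0 gi) coef0 phi0.
rewrite (big_ord_widen _ (fun j => phi i j g`_i`_j) (gin i)) big_mkcond.
apply: eq_bigr => j _; case: ltnP => // gj.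
by rewrite (nth_default 0 gj) phi0.
Qed.

Lemma pol2_bound (g : {poly {poly R}}) : exists n, forall p, (n <= p)%N ->
  (size g <= p)%N /\ (forall i, size (g`_i)%R <= p)%N.
Proof.
exists (maxn (size g) (\max_(i < size g) size (g`_i)%R)%N).
move=> p; rewrite geq_max => /andP[h1 h2]; split=> // i.
have [ig|gi] := ltnP i (size g).
  by apply: leq_trans h2; exact: (leq_bigmax (Ordinal ig)).
by rewrite (nth_default 0 gi) size_poly0.
Qed.

Lemma pext_zmod_morphism : zmod_morphism pext.
Proof.
move=> g h; have [n1 H1] := pol2_bound g; have [n2 H2] := pol2_bound h.
have [n3 H3] := pol2_bound (g - h); pose n := (n1 + n2 + n3)%N.
have [|a1 b1] := H1 n; first by rewrite /n; lia.
have [|a2 b2] := H2 n; first by rewrite /n; lia.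
have [|a3 b3] := H3 n; first by rewrite /n; lia.
rewrite !(@pext_wide n) // -sumrB; apply: eq_bigr => i _.
by rewrite -sumrB; apply: eq_bigr => j _; rewrite !coefB phiB.
Qed.
HB.instance Definition _ :=
  GRing.isZmodMorphism.Build {poly {poly R}} V pext pext_zmod_morphism.

Lemma pext_mon i j c : pext (pmon i j c) = phi i j c.
Proof.
have [n H] := pol2_bound (pmon i j c); pose p := (n + i.+1 + j.+1)%N.
have [|a b] := H p; first by rewrite /p; lia.
have ip : (i < p)%N by rewrite /p; lia.
have jp : (j < p)%N by rewrite /p; lia.
have neq k l (lp : (l < p)%N) : k != Ordinal lp -> (k == l :> nat) = false.
  by move=> kl; apply/eqP => e; case/eqP: kl; apply/val_inj.
rewrite (@pext_wide p) // pmonE (bigD1 (Ordinal ip)) //= [X in _ + X]big1 ?addr0.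
  rewrite (bigD1 (Ordinal jp)) //= [X in _ + X]big1 ?addr0 => [|k kj].
    by rewrite !coefCM !coefXn !eqxx !mulr1 coefCM coefXn eqxx mulr1.
  by rewrite coefCM coefXn eqxx mulr1 coefCM coefXn (neq _ _ _ kj) mulr0 phi0.
move=> k ki; apply: big1 => l _.
by rewrite coefCM coefXn (neq _ _ _ ki) mulr0 coef0 phi0.
Qed.

End Extension.

Definition inc : pol2 int -> pol2 R := map_poly (map_poly (intr : int -> R)).
HB.instance Definition _ := GRing.RMorphism.on inc.

End BivariatePolynomials.
Arguments inc : clear implicits.

Lemma inc_mon (R : comNzRingType) i j (c : int) :
  inc R (pmon i j c) = pmon i j c%:~R.
Proof.
rewrite /pmon !rmorphM !rmorphXn /= /inc /pX /pY /emb !map_polyX.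
by rewrite !map_polyC /= map_polyX map_polyC.
Qed.

Notation pol := (pol2 int).

(** Functions of n + 1 points of the plane: st_ring n is the ring of polynomials
    in n + 1 pairs of variables, one pair per slot, the outermost slot being the
    first. A polynomial in two variables is placed in that slot by st_inc, while
    st_emb adds a new slot in front of the existing ones. The fields are the
    properties that characterize the construction. They are all that is used,
    and keeping the construction opaque prevents the nested polynomial rings
    from being unfolded. *)
Record slot_tower := SlotTower {
  st_ring : nat -> comNzRingType;
  st_0 : {rmorphism pol -> st_ring 0};
  st_0inv : st_ring 0 -> pol;
  st_0K : cancel st_0 st_0inv;
  st_0invK : cancel st_0inv st_0;
  st_X : forall n, st_ring n.+1;
  st_Y : forall n, st_ring n.+1;
  st_emb : forall n, {rmorphism st_ring n -> st_ring n.+1};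
  st_inc : forall n, {rmorphism pol -> st_ring n.+1};
  st_inc_mon : forall n i j (c : int),
    st_inc n (pmon i j c) = st_X n ^+ i * st_Y n ^+ j * st_emb n c%:~R;
  st_ind : forall n (Q : st_ring n.+1 -> Prop),
    Q 0 -> (forall a b, Q a -> Q b -> Q (a - b)) ->
    (forall i j c, Q (st_X n ^+ i * st_Y n ^+ j * st_emb n c)) -> forall g, Q g;
  st_ext : forall n (V : zmodType),
    (nat -> nat -> st_ring n -> V) -> st_ring n.+1 -> V;
  st_extB : forall n (V : zmodType) (phi : nat -> nat -> st_ring n -> V),
    (forall i j a b, phi i j (a - b) = phi i j a - phi i j b) ->
    forall a b, st_ext phi (a - b) = st_ext phi a - st_ext phi b;
  st_ext_mon : forall n (V : zmodType) (phi : nat -> nat -> st_ring n -> V),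
    (forall i j a b, phi i j (a - b) = phi i j a - phi i j b) ->
    forall i j c, st_ext phi (st_X n ^+ i * st_Y n ^+ j * st_emb n c) = phi i j c
}.

Fact slot_tower_exists : slot_tower.
Proof.
pose ring := fix ring n : comNzRingType := if n is n'.+1 then pol2 (ring n') else pol.
apply: (@SlotTower ring idfun idfun _ _ (fun n => pX (ring n)) (fun n => pY (ring n))
  (fun n => @emb (ring n)) (fun n => inc (ring n)) _ _ (fun n => @pext (ring n))) => //.
- by move=> n i j c; apply: inc_mon.
- by move=> n; apply: pol2_ind.
- by move=> n V phi phiB; apply: pext_zmod_morphism.
- by move=> n V phi phiB; apply: pext_mon.
Qed.

Section Slots.

Definition slots := st_ring slot_tower_exists.
Definition slot0 : pol -> slots 0 := st_0 _.
Definition sX n : slots n.+1 := st_X _ n.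
Definition sY n : slots n.+1 := st_Y _ n.
Definition semb n : slots n -> slots n.+1 := @st_emb _ n.
Definition sinc n : pol -> slots n.+1 := @st_inc _ n.
HB.instance Definition _ := GRing.RMorphism.copy slot0 (st_0 slot_tower_exists).
HB.instance Definition _ n := GRing.RMorphism.copy (@semb n) (st_emb slot_tower_exists n).
HB.instance Definition _ n := GRing.RMorphism.copy (@sinc n) (st_inc slot_tower_exists n).

Definition smon n i j (c : slots n) : slots n.+1 := sX n ^+ i * sY n ^+ j * semb c.

Lemma smonM n i j c i' j' c' :
  smon i j c * smon i' j' c' = @smon n (i + i') (j + j') (c * c').
Proof. by rewrite /smon !exprD rmorphM; ring. Qed.

Lemma sinc_mon n i j (c : int) : sinc n (pmon i j c) = smon i j c%:~R.
Proof. exact: st_inc_mon. Qed.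

Lemma sinc_X n : sinc n (pX _) = sX n.
Proof.
have -> : pX _ = pmon 1 0 1 :> pol by rewrite /pmon expr1 expr0 rmorph1 !mulr1.
by rewrite sinc_mon /smon expr1 expr0 rmorph1 !mulr1.
Qed.

Lemma sinc_Y n : sinc n (pY _) = sY n.
Proof.
have -> : pY _ = pmon 0 1 1 :> pol by rewrite /pmon expr1 expr0 rmorph1 mulr1 mul1r.
by rewrite sinc_mon /smon expr1 expr0 rmorph1 mulr1 mul1r.
Qed.

Definition unslot0 : slots 0 -> pol := @st_0inv _.
Lemma slot0K : cancel slot0 unslot0. Proof. exact: st_0K. Qed.
Lemma slot0_onto g : exists p, g = slot0 p.
Proof. by exists (unslot0 g); rewrite /slot0 /unslot0 st_0invK. Qed.

Lemma smon_ind n (Q : slots n.+1 -> Prop) :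
    Q 0 -> (forall a b, Q a -> Q b -> Q (a - b)) -> (forall i j c, Q (smon i j c)) ->
  forall g, Q g.
Proof. exact: st_ind. Qed.

Definition sext n (V : zmodType) (phi : nat -> nat -> slots n -> V) : slots n.+1 -> V :=
  st_ext phi.

Lemma sextB n (V : zmodType) (phi : nat -> nat -> slots n -> V) :
    (forall i j a b, phi i j (a - b) = phi i j a - phi i j b) ->
  forall a b, sext phi (a - b) = sext phi a - sext phi b.
Proof. exact: st_extB. Qed.

Lemma sext_mon n (V : zmodType) (phi : nat -> nat -> slots n -> V) :
    (forall i j a b, phi i j (a - b) = phi i j a - phi i j b) ->
  forall i j c, sext phi (smon i j c) = phi i j c.
Proof. exact: st_ext_mon. Qed.

Lemma slots_ind n (Q : slots n.+1 -> Prop) :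
    Q 0 -> (forall a b, Q a -> Q b -> Q (a - b)) ->
    (forall p c, Q (sinc n p * semb c)) -> forall g, Q g.
Proof.
move=> Q0 QB Qp; apply: smon_ind => // i j c.
by have := Qp (pmon i j 1) c; rewrite sinc_mon /smon !rmorph1 mulr1.
Qed.

End Slots.

(** * Iterated commutators as functions of several points *)
Section Evaluation.
Variables (A : pzRingType) (x y : A).
Hypothesis gen : generated x y.
Local Notation N := (slcs A).
Local Notation deg2 := (@deg2 A).

Definition mono i j : A := x ^+ i * y ^+ j.

(** Evaluation with all the x on the left of all the y. It is multiplicative
    only modulo deg2 (evM). *)
Definition ev : pol -> A := pext (fun i j c => mono i j *~ c).

Fact ev_zmod_morphism : zmod_morphism ev.
Proof. by apply: pext_zmod_morphism => i j a b; rewrite mulrzBr. Qed.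
HB.instance Definition _ := GRing.isZmodMorphism.Build pol A ev ev_zmod_morphism.

Lemma ev_mon i j c : ev (pmon i j c) = mono i j *~ c.
Proof. by apply: pext_mon => {i j c} i j a b; rewrite mulrzBr. Qed.

(** The product of p_0, ..., p_n, with p_i in slot i, is sent to the iterated
    commutator [ev p_0, [ev p_1, ... ev p_n]] (T_inc). *)
Fixpoint T n : slots n -> A :=
  if n is n'.+1 then sext (fun i j c => ⟦mono i j, @T n' c⟧) else ev \o unslot0.

Lemma T_slot0 p : T (slot0 p) = ev p.
Proof. by rewrite /= slot0K. Qed.

Lemma TSE n : @T n.+1 = sext (fun i j c => ⟦mono i j, T c⟧). Proof. by []. Qed.

Arguments T : simpl never.

Fact T_zmod_morphism n : zmod_morphism (@T n).
Proof.
elim: n => [|n IHn a b].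
  by move=> a b; have [p ->] := slot0_onto a; have [q ->] := slot0_onto b;
    rewrite -raddfB !T_slot0 raddfB.
by rewrite TSE; apply: sextB => i j c d; rewrite IHn ring_commBr.
Qed.
HB.instance Definition _ n :=
  GRing.isZmodMorphism.Build (slots n) A (@T n) (@T_zmod_morphism n).

Lemma T_B n (a b : slots n) : T (a - b) = T a - T b.
Proof. exact: T_zmod_morphism. Qed.
Lemma T_0 n : @T n 0 = 0. Proof. exact: raddf0. Qed.

Lemma T_mon n i j (c : slots n) : T (smon i j c) = ⟦mono i j, T c⟧.
Proof. by rewrite TSE sext_mon // => {i j c} i j a b; rewrite T_B ring_commBr. Qed.

Lemma T_inc n (p : pol) (c : slots n) : T (sinc n p * semb c) = ⟦ev p, T c⟧.
Proof.
move: p; apply: pol2_ind => [|p q hp hq|i j z].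
- by rewrite !raddf0 mul0r T_0 ring_comm0l.
- by rewrite !raddfB mulrBl T_B hp hq ring_commBl.
rewrite sinc_mon /smon -mulrA -rmorphM -/(smon _ _ _) T_mon ev_mon.
by rewrite mulrzl raddfMz ring_commMzl ring_commMzr.
Qed.

Lemma T_lcs n (g : slots n) : T g \in lcs A n.+1.
Proof.
elim: n g => // n IHn; apply: slots_ind => [|a b ha hb|p c].
- by rewrite T_0 rpred0.
- by rewrite T_B rpredB.
by rewrite T_inc; apply: lcs_comm.
Qed.

Lemma ev1 : ev 1 = 1.
Proof.
have -> : 1 = pmon 0 0 1 :> pol by rewrite /pmon !expr0 !mul1r rmorph1.
by rewrite ev_mon mulr1z /mono !expr0 mulr1.
Qed.

(** Reordering a product of monomials only produces multiples of commutators. *)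
Lemma evM p q : deg2 (ev (p * q) - ev p * ev q).
Proof.
move: p q; apply: pol2_ind => [q|p p' hp hp' q|i j c].
- by rewrite mul0r !raddf0 mul0r subr0; apply: deg2_0.
- have -> : ev ((p - p') * q) - ev (p - p') * ev q =
    (ev (p * q) - ev p * ev q) - (ev (p' * q) - ev p' * ev q).
    by rewrite mulrBl !raddfB; ncring.
  by apply: deg2B.
apply: pol2_ind => [|q q' hq hq'|k l d].
- by rewrite mulr0 !raddf0 mulr0 subr0; apply: deg2_0.
- set p := pmon _ _ _ in hq hq' *.
  have -> : ev (p * (q - q')) - ev p * ev (q - q') =
    (ev (p * q) - ev p * ev q) - (ev (p * q') - ev p * ev q').
    by rewrite mulrBr !raddfB; ncring.
  by apply: deg2B.
rewrite pmonM !ev_mon mulrzAl mulrzAr -mulrzA (mulrC d) -mulrzBl mulrzA.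
suff h : deg2 (mono (i + k) (j + l) - mono i j * mono k l).
  rewrite -mulrzl -(mulrzl _ c); do 2!apply: deg2Ml.
  exact: h.
have -> : mono (i + k) (j + l) - mono i j * mono k l =
    x ^+ i * ⟦x ^+ k, y ^+ j⟧ * y ^+ l.
  by rewrite /mono !exprD /ring_comm !mulrA mulrBr mulrBl !mulrA.
by apply: deg2M; apply: (deg2_comm gen).
Qed.

Lemma ev_surj a : exists p, deg2 (a - ev p).
Proof.
move: a; apply: gen.
- by exists 1; rewrite ev1 subrr; apply: deg2_0.
- exists (pmon 1 0 1); rewrite ev_mon /mono expr1 expr0 mulr1 mulr1z subrr.
  exact: deg2_0.
- exists (pmon 0 1 1); rewrite ev_mon /mono expr1 expr0 mul1r mulr1z subrr.
  exact: deg2_0.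
- move=> a b [p hp] [q hq]; exists (p - q).
  have -> : a - b - ev (p - q) = (a - ev p) - (b - ev q) by rewrite raddfB; ncring.
  exact: deg2B.
move=> a b [p hp] [q hq]; exists (p * q).
have -> : a * b - ev (p * q) =
    (a - ev p) * b + ev p * (b - ev q) - (ev (p * q) - ev p * ev q) by ncring.
apply: deg2B (evM p q); apply: deg2D; first exact: deg2Mr.
exact: deg2Ml.
Qed.

(** In an iterated commutator every entry can be changed by an element of deg2,
    hence replaced by a value of ev. *)
Lemma T_surj n a : a \in lcs A n.+2 -> exists g : slots n.+1, a - T g \in N n.+3.
Proof.
have diff n' b c (g h : slots n') : b - c - T (g - h) = (b - T g) - (c - T h).
  by rewrite T_B; ncring.
elim: n a => [|n IHn]; apply: lcs_ind => //.
- by exists 0; rewrite T_0 subr0 rpred0.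
- by move=> a b [g hg] [h hh]; exists (g - h); rewrite diff rpredB.
- move=> a b _; have [p hp] := ev_surj a; have [q hq] := ev_surj b.
  exists (sinc 0 p * semb (slot0 q)); rewrite T_inc T_slot0.
  have -> : ⟦a, b⟧ - ⟦ev p, ev q⟧ = ⟦a - ev p, b⟧ - ⟦b - ev q, ev p⟧ by ncring.
  by apply: rpredB; apply: (@deg2_lcs _ 1) => //; apply: mem_slcs.
- by exists 0; rewrite T_0 subr0 rpred0.
- by move=> a b [g hg] [h hh]; exists (g - h); rewrite diff rpredB.
move=> a b bL; have [p hp] := ev_surj a; have [h hh] := IHn b bL.
exists (sinc n.+1 p * semb h); rewrite T_inc.
have -> : ⟦a, b⟧ - ⟦ev p, T h⟧ = ⟦a - ev p, b⟧ + ⟦ev p, b - T h⟧ by ncring.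
apply: rpredD; last exact: slcs_comm.
by apply: deg2_lcs => //; apply: mem_slcs.
Qed.

End Evaluation.
Arguments T : simpl never.

(** * Locality of iterated commutators *)
Section Polarization.
Variables (P S : comNzRingType) (K : zmodClosed S).
Hypothesis Kdiv : forall g n, g *+ n.+1 \in K -> g \in K.

(** Polarization of a quartic form: the integers that it introduces can be
    divided out. *)
Lemma polarize4 (d : {additive P -> S}) h :
    (forall a, d a ^+ 4 * h \in K) ->
  forall a b c e, d a * d b * d c * d e * h \in K.
Proof.
move=> d4.
have d22 a b : d a ^+ 2 * d b ^+ 2 * h \in K.
  apply: (@Kdiv _ 11); have -> : d a ^+ 2 * d b ^+ 2 * h *+ 12 =
    d (a + b) ^+ 4 * h + d (a - b) ^+ 4 * h - d a ^+ 4 * h *+ 2 - d b ^+ 4 * h *+ 2.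
    by rewrite raddfD raddfB; ring.
  by rewrite !rpredB ?rpredD ?rpredMn.
have d112 a c b : d a * d c * d b ^+ 2 * h \in K.
  apply: (@Kdiv _ 1); have -> : d a * d c * d b ^+ 2 * h *+ 2 =
    d (a + c) ^+ 2 * d b ^+ 2 * h - d a ^+ 2 * d b ^+ 2 * h - d c ^+ 2 * d b ^+ 2 * h.
    by rewrite raddfD; ring.
  by rewrite !rpredB.
move=> a b c e; apply: (@Kdiv _ 1); have -> : d a * d b * d c * d e * h *+ 2 =
    d a * d b * d (c + e) ^+ 2 * h - d a * d b * d c ^+ 2 * h - d a * d b * d e ^+ 2 * h.
  by rewrite raddfD; ring.
by rewrite !rpredB.
Qed.

(** In the applications i1 and i2 place a polynomial in two adjacent slots, so
    that d a is the difference of the values of a at two points, and T sends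
    B p q to the bracket of [p, q] with the remaining entries. *)
Variables (i1 i2 : {rmorphism P -> S}).
Let d a := i1 a - i2 a.
Let B p q := i1 p * i2 q - i1 q * i2 p.

(** A product of three differences times i1 p is, up to the factor 6, the sum of
    a product of four differences, of cyclic sums and of a value of B at 1. A
    further factor i2 q is absorbed into one of the differences. *)
Lemma cyclic_kills_order3 h :
    (forall a b c e, d a * d b * d c * d e * h \in K) ->
    (forall p q r, (B (p * q) r + B (q * r) p + B (r * p) q) * h \in K) ->
    (forall p, B p 1 * h \in K) ->
  forall p q a b c, i1 p * i2 q * (d a * d b * d c) * h \in K.
Proof.
move=> d4 cyc B1.
have one p a b c : i1 p * (d a * d b * d c) * h \in K.
  apply: (@Kdiv _ 5).
  pose Z p q r := (B (p * q) r + B (q * r) p + B (r * p) q) * h.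
  have -> : i1 p * (d a * d b * d c) * h *+ 6 =
      d p * d a * d b * d c * h *+ 3 +
      (B (a * b * c * p) 1 * h *+ 3 +
      ((Z (a * b) p c + Z (a * c) p b + Z (b * c) p a) -
       (Z (a * p) b c + Z (b * p) a c + Z (c * p) a b) *+ 2)).
    by rewrite /Z /B /d !rmorphM !rmorph1; ring.
  have ZK p' q r : Z p' q r \in K by apply: cyc.
  by do ?[apply: rpredMn | apply: rpredB | apply: rpredD] => //.
move=> p q a b c.
have -> : i1 p * i2 q * (d a * d b * d c) * h =
    i1 p * (d a * d b * d (q * c)) * h - i1 (p * c) * (d a * d b * d q) * h.
  by rewrite /d !rmorphM; ring.
by rewrite rpredB.
Qed.

(** With nothing to the right of the two slots, i1 p * i2 q itself has the
    symmetries that B has in cyclic_kills_order3, and this saves one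
    difference. *)
Lemma cyclic_kills_order2 :
    (forall p q, i1 p * i2 q + i1 q * i2 p \in K) ->
    (forall p q r, i1 (p * q) * i2 r + i1 (q * r) * i2 p + i1 (r * p) * i2 q \in K) ->
  forall p q a b, i1 p * i2 q * (d a * d b) \in K.
Proof.
move=> sym cyc.
have i1K p : i1 p \in K.
  have := sym p 1; have := cyc p 1 1; rewrite !rmorph1 !mulr1 !mul1r !rmorph1.
  by rewrite !(mulr1, mul1r) => h s; rewrite rpredDl in h.
have one p a b : i1 p * (d a * d b) \in K.
  have -> : i1 p * (d a * d b) =
    i1 (p * a * b) +  (i1 p * i2 (a * b) + i1 (a * b) * i2 p)
    - (i1 (p * a) * i2 b + i1 (a * b) * i2 p + i1 (b * p) * i2 a).
    by rewrite /d !rmorphM; ring.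
  by apply: rpredB => //; apply: rpredD => //; apply: sym.
move=> p q a b.
have -> : i1 p * i2 q * (d a * d b) =
    i1 p * (d a * d (q * b)) - i1 (p * b) * (d a * d q).
  by rewrite /d !rmorphM; ring.
by rewrite rpredB.
Qed.

End Polarization.

Section Locality.
Variables (A : pzRingType) (x y : A).
Hypothesis gen : generated x y.
Local Notation N := (slcs A).
Local Notation T := (@T A x y _).
Local Notation ev := (@ev A x y).

Definition Tker n : {pred slots n} := fun g => T g \in N n.+2.

Lemma TkerE n (g : slots n) : (g \in @Tker n) = (T g \in N n.+2).
Proof. by []. Qed.

Fact Tker_zmod_closed n : zmod_closed (@Tker n).
Proof.
split=> [|a b]; rewrite !TkerE ?T_0 ?rpred0 //.
by move=> ha hb; rewrite T_B rpredB.
Qed.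
HB.instance Definition _ n :=
  GRing.isZmodClosed.Build (slots n) (@Tker n) (@Tker_zmod_closed n).

Lemma Tker_div n (g : slots n) k : g *+ k.+1 \in @Tker n -> g \in @Tker n.
Proof. by rewrite !TkerE raddfMn; apply: sat_divn. Qed.

Lemma Tker_emb n u : (forall c, u * c \in @Tker n) ->
  forall g : slots n.+1, semb u * g \in @Tker n.+1.
Proof.
move=> uK; apply: slots_ind => [|a b ha hb|p c].
- by rewrite mulr0 rpred0.
- by rewrite mulrBr rpredB.
by rewrite mulrCA -rmorphM TkerE T_inc; apply: slcs_comm => //; apply: uK.
Qed.

Section ThreeSlots.
Variable n : nat.
Definition in1 (p : pol) : slots n.+2 := sinc n.+1 p.
Definition in2 (p : pol) : slots n.+2 := semb (sinc n p).
HB.instance Definition _ := GRing.RMorphism.copy in1 (@sinc n.+1).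
HB.instance Definition _ := GRing.RMorphism.copy in2 (@semb n.+1 \o sinc n).
Definition in3 (h : slots n) : slots n.+2 := semb (semb h).

Lemma T_in12 p q (h : slots n) :
  T (in1 p * in2 q * in3 h) = ⟦ev p, ⟦ev q, T h⟧⟧.
Proof. by rewrite -mulrA /in1 /in2 /in3 -rmorphM T_inc T_inc. Qed.

Lemma ev_approx p q a b (h : slots n) : deg2 (ev p - a) -> deg2 (ev q - b) ->
  T (in1 p * in2 q * in3 h) - ⟦a, ⟦b, T h⟧⟧ \in N n.+4.
Proof.
move=> pa qb; rewrite T_in12.
have -> : ⟦ev p, ⟦ev q, T h⟧⟧ - ⟦a, ⟦b, T h⟧⟧ =
   ⟦ev p - a, ⟦ev q, T h⟧⟧ + ⟦a, ⟦ev q - b, T h⟧⟧ by ncring.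
have hL : T h \in N n.+1 by apply/mem_slcs/T_lcs.
apply: rpredD; first by apply: deg2_lcs => //; apply: slcs_comm.
by apply: slcs_comm => //; apply: deg2_lcs.
Qed.

Lemma T_comm12 p q (h : slots n) :
  T ((in1 p * in2 q - in1 q * in2 p) * in3 h) = ⟦⟦ev p, ev q⟧, T h⟧.
Proof. by rewrite mulrBl T_B !T_in12; ncring. Qed.

Lemma ev_sqr a : deg2 (ev (a ^+ 2) - ev a ^+ 2).
Proof. exact: evM. Qed.

Lemma ev_cube a : deg2 (ev (a ^+ 3) - ev a ^+ 3).
Proof.
have -> : ev (a ^+ 3) - ev a ^+ 3 =
    (ev (a * a ^+ 2) - ev a * ev (a ^+ 2)) + ev a * (ev (a ^+ 2) - ev a ^+ 2).
  by rewrite -exprS mulrBr addrA subrK -exprS.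
by apply: deg2D; [exact: evM | apply/deg2Ml/ev_sqr].
Qed.

(** The fourth power expands to 6 [a^2, [a^2, w]] - 4 [a^3, [a, w]]
    - 4 [a, [a^3, w]] = -2 [a, [a, [a, [a, w]]]], which lies two steps further
    down the series than the double commutators it is made of. *)
Lemma quartic_local a (h : slots n) :
  (in1 a - in2 a) ^+ 4 * in3 h \in @Tker n.+2.
Proof.
pose t p q := in1 p * in2 q * in3 h.
have -> : (in1 a - in2 a) ^+ 4 * in3 h = t (a ^+ 4) 1 + t 1 (a ^+ 4)
    + (t (a ^+ 2) (a ^+ 2) *+ 6 - t (a ^+ 3) a *+ 4 - t a (a ^+ 3) *+ 4).
  by rewrite /t !rmorphXn !rmorph1; ring.
set w := T h; have wL : w \in lcs A n.+1 by apply: T_lcs.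
apply: rpredD.
  rewrite TkerE /t raddfD /= !T_in12 ev1 !ring_comm1l ring_comm0r addr0.
  exact: rpred0.
rewrite TkerE !T_B !(raddfMn T).
set c := ev a; have deg2cc : deg2 (ev a - c) by rewrite subrr; apply: deg2_0.
have h22 := @ev_approx _ _ _ _ h (ev_sqr a) (ev_sqr a).
have h31 := @ev_approx _ _ _ _ h (ev_cube a) deg2cc.
have h13 := @ev_approx _ _ _ _ h deg2cc (ev_cube a).
have ad4 : ⟦c, ⟦c, ⟦c, ⟦c, w⟧⟧⟧⟧ \in N n.+4.
  by apply: mem_slcs; apply: (@lcsS _ n.+4); do 4!apply: lcs_comm => //.
rewrite -/w -/c in h22 h31 h13.
have -> : T (t (a ^+ 2) (a ^+ 2)) *+ 6 - T (t (a ^+ 3) a) *+ 4 - T (t a (a ^+ 3)) *+ 4 =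
    (T (t (a ^+ 2) (a ^+ 2)) - ⟦c ^+ 2, ⟦c ^+ 2, w⟧⟧) *+ 6
    - (T (t (a ^+ 3) a) - ⟦c ^+ 3, ⟦c, w⟧⟧) *+ 4
    - (T (t a (a ^+ 3)) - ⟦c, ⟦c ^+ 3, w⟧⟧) *+ 4
    - ⟦c, ⟦c, ⟦c, ⟦c, w⟧⟧⟧⟧ *+ 2.
  by ncring.
by rewrite !rpredB ?rpredMn.
Qed.

(** This is [pq, r] + [qr, p] + [rp, q] = 0, an identity of associative rings. *)
Lemma cyclic_local p q r (h : slots n) :
  (in1 (p * q) * in2 r - in1 r * in2 (p * q) +
   (in1 (q * r) * in2 p - in1 p * in2 (q * r)) +
   (in1 (r * p) * in2 q - in1 q * in2 (r * p)))
    * in3 h \in @Tker n.+2.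
Proof.
rewrite 2!(mulrDl _ _ (in3 h)) TkerE 2!(raddfD T) /= 3!T_comm12.
have approx a b c : ⟦⟦ev (a * b), ev c⟧, T h⟧ - ⟦⟦ev a * ev b, ev c⟧, T h⟧ \in N n.+4.
  rewrite -ring_commBl -ring_commBl -[n.+4]/(3 + n.+1)%N; apply: slcs_commD => //.
    apply: (@deg2_lcs _ 1) => //; first exact: evM.
    exact: mem_slcs.
  by apply: mem_slcs; apply: T_lcs.
set w := T h in approx *.
have -> : ⟦⟦ev (p * q), ev r⟧, w⟧ + ⟦⟦ev (q * r), ev p⟧, w⟧ + ⟦⟦ev (r * p), ev q⟧, w⟧ =
    (⟦⟦ev (p * q), ev r⟧, w⟧ - ⟦⟦ev p * ev q, ev r⟧, w⟧)
    + (⟦⟦ev (q * r), ev p⟧, w⟧ - ⟦⟦ev q * ev r, ev p⟧, w⟧)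
    + (⟦⟦ev (r * p), ev q⟧, w⟧ - ⟦⟦ev r * ev p, ev q⟧, w⟧) by ncring.
exact: rpredD (rpredD (approx _ _ _) (approx _ _ _)) (approx _ _ _).
Qed.

(** Products of four differences die by polarizing quartic_local, and
    cyclic_local lowers this to three. *)
Lemma local3 (a b c : pol) g :
  (in1 a - in2 a) * (in1 b - in2 b) * (in1 c - in2 c) * g \in @Tker n.+2.
Proof.
have d4 (h : slots n) a' b' c' e' :
   (in1 a' - in2 a') * (in1 b' - in2 b') * (in1 c' - in2 c') * (in1 e' - in2 e') *
     in3 h \in @Tker n.+2.
  pose d : {additive pol -> slots n.+2} := in1 \- in2.
  apply: (@polarize4 _ _ (@Tker n.+2) (@Tker_div _) d) => u; exact: quartic_local.
move: g; apply: slots_ind => [|g g' hg hg'|p c'].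
- by rewrite mulr0; apply: rpred0.
- by rewrite mulrBr; apply: rpredB.
move: c'; apply: slots_ind => [|g g' hg hg'|q h].
- by rewrite raddf0 !mulr0 rpred0.
- rewrite raddfB (mulrBr (sinc _ _)) (mulrBr (_ * (in1 c - in2 c))); exact: rpredB.
rewrite rmorphM /= -/(in1 p) -/(in2 q) -/(in3 h).
rewrite (_ : _ * _ = in1 p * in2 q * ((in1 a - in2 a) * (in1 b - in2 b) * (in1 c - in2 c)) * in3 h);
  last by ring.
apply: (@cyclic_kills_order3 _ _ (@Tker n.+2) (@Tker_div _) in1 in2 (in3 h)).
- exact: d4.
- by move=> p' q' r'; apply: cyclic_local.
by move=> p'; rewrite TkerE T_comm12 ev1 (ring_commC _ 1) ring_comm1l oppr0 ring_comm0l rpred0.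
Qed.

End ThreeSlots.

Lemma local2 (a b : pol) (g : slots 1) :
  (sinc 0 a - semb (slot0 a)) * (sinc 0 b - semb (slot0 b)) * g \in @Tker 1.
Proof.
pose i2 (p : pol) : slots 1 := semb (slot0 p).
pose i2R : {rmorphism pol -> slots 1} := @semb 0 \o slot0.
move: g; apply: slots_ind => [|g g' hg hg'|p c].
- by rewrite mulr0 rpred0.
- by rewrite mulrBr rpredB.
have [q ->] := slot0_onto c.
have -> : (sinc 0 a - semb (slot0 a)) * (sinc 0 b - semb (slot0 b)) *
    (sinc 0 p * semb (slot0 q)) =
  sinc 0 p * i2R q * ((sinc 0 a - i2R a) * (sinc 0 b - i2R b)) by rewrite /=; ring.
have Ti p' q' : T (sinc 0 p' * i2R q') = ⟦ev p', ev q'⟧ by rewrite T_inc T_slot0.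
apply: (@cyclic_kills_order2 _ _ (@Tker 1) (@sinc 0) i2R) => {p q a b c} [p q|p q r].
  by rewrite TkerE raddfD /= !Ti (ring_commC (ev q)) subrr rpred0.
rewrite TkerE !raddfD /= !Ti.
have approx a b c : ⟦ev (a * b), ev c⟧ - ⟦ev a * ev b, ev c⟧ \in N 3.
  rewrite -ring_commBl; apply: (@deg2_lcs _ 1) => //; first exact: evM.
  exact: mem_slcs.
have -> : ⟦ev (p * q), ev r⟧ + ⟦ev (q * r), ev p⟧ + ⟦ev (r * p), ev q⟧ =
    (⟦ev (p * q), ev r⟧ - ⟦ev p * ev q, ev r⟧)
    + (⟦ev (q * r), ev p⟧ - ⟦ev q * ev r, ev p⟧)
    + (⟦ev (r * p), ev q⟧ - ⟦ev r * ev p, ev q⟧) by ncring.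
exact: rpredD (rpredD (approx _ _ _) (approx _ _ _)) (approx _ _ _).
Qed.

End Locality.

(** * Coordinates, differences and words *)
Section Coordinates.

Definition base n (b : bool) : slots n :=
  match n with
  | 0 => slot0 (if b then pY int else pX int)
  | n'.+1 => if b then sY n' else sX n'
  end.

(** Past the last slot the coordinate stays that of the last slot, so that the
    differences taken there vanish (lab_out). *)
Fixpoint scoord n (b : bool) (i : nat) : slots n :=
  match n, i with
  | n'.+1, i'.+1 => semb (scoord n' b i')
  | n, _ => base n b
  end.

Lemma coord0 n b : scoord n b 0 = base n b. Proof. by case: n. Qed.
Lemma coordS n b i : scoord n.+1 b i.+1 = semb (scoord n b i). Proof. by []. Qed.
Lemma coord_last b i : scoord 0 b i = base 0 b. Proof. by []. Qed.

Arguments scoord : simpl never.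

(** The label (b, None) stands for the coordinate x or y (if b holds) of the
    first slot, (b, Some i) for the difference of that coordinate between the
    slots i + 1 and i. In these generators of the ring, the vanishing of T on
    products of differences becomes a condition on monomials. *)
Definition label := (bool * option nat)%type.

Definition lab n (l : label) : slots n :=
  if l.2 is Some i then scoord n l.1 i.+1 - scoord n l.1 i else base n l.1.

Definition word n (w : seq label) : slots n := \prod_(l <- w) lab n l.

Definition worder (w : seq label) : nat := count (fun l => isSome l.2) w.

(** A product of coordinates, each given by its variable and its slot; contrary
    to words, T maps it to a single iterated commutator. *)
Definition cword n (s : seq (bool * nat)) : slots n := \prod_(c <- s) scoord n c.1 c.2.

(** The filtration by the number of differences, in a fixed degree d. *)
Definition wspan n d p : {pred slots n} :=
  zspan (fun g => `[< exists w, [/\ size w = d, (p <= worder w)%N & g = word n w] >]).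
HB.instance Definition _ n d p := GRing.ZmodClosed.on (@wspan n d p).

Lemma mem_word n w d p : size w = d -> (p <= worder w)%N -> word n w \in @wspan n d p.
Proof. by move=> wd wp; apply: mem_zspan; apply/asboolP; exists w. Qed.

Lemma wspan_min n d p (U : zmodClosed (slots n)) :
    (forall w, size w = d -> (p <= worder w)%N -> word n w \in U) ->
  {subset @wspan n d p <= U}.
Proof. by move=> wU; apply: zspan_min => g /asboolP[w [wd wp ->]]; apply: wU. Qed.

Lemma wspanS n d p q : (q <= p)%N -> {subset @wspan n d p <= @wspan n d q}.
Proof. by move=> qp; apply: wspan_min => w wd wp; apply: mem_word => //; lia. Qed.

Lemma wordM n w w' : word n w * word n w' = word n (w ++ w').
Proof. by rewrite /word big_cat. Qed.

Lemma wspanM n d p d' p' a b : a \in @wspan n d p -> b \in @wspan n d' p' ->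
  a * b \in @wspan n (d + d') (p + p').
Proof.
apply: zspanM => {}a {}b /asboolP[w [wd wp ->]] /asboolP[w' [wd' wp' ->]].
rewrite wordM; apply: mem_word; first by rewrite size_cat wd wd'.
by rewrite /worder count_cat leq_add.
Qed.

Lemma wspan1 n : 1 \in @wspan n 0 0.
Proof. by have := @mem_word n [::] 0 0 erefl erefl; rewrite /word big_nil. Qed.

Lemma word1 n l : word n [:: l] = lab n l.
Proof. exact: big_seq1. Qed.

Lemma lab_wspan n l : lab n l \in @wspan n 1 (isSome l.2).
Proof.
by rewrite -word1; apply: mem_word; rewrite // /worder /= addn0.
Qed.

Lemma base_wspan n b : base n b \in @wspan n 1 0.
Proof. exact: (@lab_wspan n (b, None)). Qed.

Lemma coordB_wspan n b i : scoord n b i - base n b \in @wspan n 1 1.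
Proof.
elim: i => [|i IHi]; first by rewrite coord0 subrr rpred0.
have -> : scoord n b i.+1 - base n b = lab n (b, Some i) + (scoord n b i - base n b).
  by rewrite /lab /= addrA subrK.
by apply: rpredD => //; apply: (@lab_wspan n (b, Some i)).
Qed.

Lemma coord_wspan n b i : scoord n b i \in @wspan n 1 0.
Proof.
rewrite -[scoord n b i](subrK (base n b)) rpredD ?base_wspan //.
exact/(wspanS _ (coordB_wspan n b i)).
Qed.

Lemma coordX_wspan n b i r : scoord n b i ^+ r \in @wspan n r 0.
Proof.
elim: r => [|r IHr]; first by rewrite expr0 wspan1.
rewrite exprS; exact: (wspanM (coord_wspan n b i) IHr).
Qed.

Lemma baseX_wspan n b r : base n b ^+ r \in @wspan n r 0.
Proof. by rewrite -coord0 coordX_wspan. Qed.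

Lemma coordXB_wspan n b i r : scoord n b i ^+ r - base n b ^+ r \in @wspan n r 1.
Proof.
elim: r => [|r IHr]; first by rewrite !expr0 subrr rpred0.
have -> : scoord n b i ^+ r.+1 - base n b ^+ r.+1 =
   scoord n b i * (scoord n b i ^+ r - base n b ^+ r)
   + (scoord n b i - base n b) * base n b ^+ r by rewrite !exprS; ring.
apply: rpredD; first exact: (wspanM (coord_wspan n b i) IHr).
exact: (wspanM (coordB_wspan n b i) (baseX_wspan n b r)).
Qed.

Lemma word_rem n l w : l \in w -> word n w = lab n l * word n (rem l w).
Proof. by move=> lw; rewrite /word (perm_big _ (perm_to_rem lw)) big_cons. Qed.

Lemma word_count n l w :
  word n w = lab n l ^+ count_mem l w * word n [seq k <- w | k != l].
Proof.
rewrite /word; elim: w => [|k w IHw] /=; first by rewrite !big_nil mulr1.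
rewrite big_cons IHw; have [->|kl] := eqVneq k l; first by rewrite add1n exprS mulrA.
by rewrite big_cons mulrCA.
Qed.

Lemma count_rem_label (P : pred label) w : (0 < count P w)%N ->
  exists a, [/\ P a, a \in w & count P w = (count P (rem a w)).+1].
Proof.
rewrite -has_count => /hasP[a aw Pa]; exists a; split=> //.
by rewrite (permP (perm_to_rem aw)) /= Pa.
Qed.

Lemma word_count2 n (P : pred label) w : (2 <= count P w)%N ->
  exists a b w', [/\ P a, P b, count P w = (count P w').+2 &
    word n w = lab n a * lab n b * word n w'].
Proof.
move=> w2; have [|a [Pa aw ca]] := @count_rem_label P w; first by lia.
have [|b [Pb bw cb]] := @count_rem_label P (rem a w); first by lia.
exists a, b, (rem b (rem a w)); split=> //; first by rewrite ca cb.
by rewrite (word_rem _ aw) (word_rem _ bw) !mulrA.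
Qed.

Lemma word_count3 n (P : pred label) w : (3 <= count P w)%N ->
  exists a b c w', [/\ P a, P b, P c & word n w = lab n a * lab n b * lab n c * word n w'].
Proof.
move=> w3; have [|a [b [w' [Pa Pb cw ->]]]] := @word_count2 n P w; first by lia.
have [|c [Pc cw' _]] := @count_rem_label P w'; first by lia.
by exists a, b, c, (rem c w'); split=> //; rewrite (word_rem _ cw') mulrA.
Qed.

(** Expanding the differences only brings in the coordinates at their ends, so a
    condition C on coordinates can be followed from the labels to the terms. *)
Lemma word_cword n (C : pred (bool * nat)) w :
    (forall l, l \in w -> if l.2 is Some i then C (l.1, i) && C (l.1, i.+1) else C (l.1, 0)) ->
  word n w \in zspan (fun g => `[< exists s, [/\ size s = size w, all C s & g = cword n s] >]).
Proof.
elim: w => [|l w IHw] wC.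
  by apply: mem_zspan; apply/asboolP; exists [::]; rewrite /word /cword !big_nil.
have {IHw} wS := IHw (fun k kw => wC k (@mem_behead _ (l :: w) k kw)).
pose P1 : {pred slots n} := fun g => `[< exists2 c, C c & g = scoord n c.1 c.2 >].
have lP : lab n l \in zspan P1.
  have := wC l (mem_head _ _); rewrite /lab; case: (l.2) => [i|] => [/andP[C1 C2]|C1].
    by apply: rpredB; apply: mem_zspan; apply/asboolP; [exists (l.1, i.+1)|exists (l.1, i)].
  by apply: mem_zspan; apply/asboolP; exists (l.1, 0); rewrite //= coord0.
rewrite /word big_cons; apply: (zspanM _ lP wS) => a b /asboolP[c cC ->] /asboolP[s [sw sC ->]].
apply: mem_zspan; apply/asboolP; exists (c :: s); split; rewrite /= ?sw ?cC //.
by rewrite /cword big_cons.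
Qed.

(** Splits off the outermost slot. The last three clauses follow the conditions
    on s under which T_cword_pure, T_cword_mixed and T_cword_first make T
    vanish. *)
Lemma cwordS n s : exists i j s',
  [/\ (i + j + size s' = size s)%N, cword n.+1 s = smon i j (cword n s'),
      (forall b, all (fun c => (c.2 == 0) || (c.1 == b)) s -> all (fun c => c.1 == b) s'),
      (forall b, all (fun c => c.1 == b) s -> if b then i = 0 else j = 0) &
      (all (fun c => c.2 == 0) s -> s' = [::])].
Proof.
elim: s => [|[b [|i]] s [i' [j' [s' [hs cE h1 h2 h3]]]]].
- by exists 0, 0, [::]; split=> // [|[]] //; rewrite /cword !big_nil /smon !expr0 !mul1r rmorph1.
- exists (~~ b + i')%N, (b + j')%N, s'; split=> //.
  + by rewrite /= -hs; case: b => /=; lia.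
  + rewrite /cword big_cons coord0 -/(cword n.+1 s) cE /smon.
    by case: b; rewrite /= ?add0n ?add1n ?exprS; [rewrite mulrA mulrCA !mulrA|rewrite !mulrA].
  + by move=> b' /= /andP[/eqP-> /h2]; case: b'.
exists i', j', ((b, i) :: s'); split.
- by rewrite /= -hs; lia.
- by rewrite /cword !big_cons coordS -/(cword n.+1 s) cE /smon rmorphM; ring.
- by move=> b' /= /andP[-> /h1].
- by move=> b' /= /andP[_ /h2].
by [].
Qed.

Lemma cword0 s : exists i j, [/\ (i + j = size s)%N, cword 0 s = slot0 (pmon i j 1) &
  forall b, all (fun c => c.1 == b) s -> if b then i = 0 else j = 0].
Proof.
elim: s => [|[b i] s [i' [j' [hs cE h2]]]].
  by exists 0, 0; split=> [||[]]; rewrite // /cword !big_nil /pmon !expr0 !mul1r rmorph1.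
exists (~~ b + i')%N, (b + j')%N; split.
- by rewrite /= -hs; case: b => /=; lia.
- rewrite /cword big_cons coord_last -/(cword 0 s) cE /pmon.
  rewrite /base -rmorphM; congr slot0.
  by case: b; rewrite /= ?add0n ?add1n ?exprS -!mulrA // mulrCA.
by move=> b' /= /andP[/eqP-> /h2]; case: b'.
Qed.

(** A coordinate is the one of the first slot plus a sum of differences. *)
Lemma word_span n (g : slots n) : g \in zspan (fun g => `[< exists w, g = word n w >]).
Proof.
pose W n : {pred slots n} := zspan (fun g => `[< exists w, g = word n w >]).
have Ww k w : word k w \in W k by apply: mem_zspan; apply/asboolP; exists w.
have WM k a b : a \in W k -> b \in W k -> a * b \in W k.
  by apply: zspanM => {}a {}b /asboolP[w ->] /asboolP[w' ->]; rewrite wordM; apply: Ww.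
have Wl k l : lab k l \in W k by rewrite -word1; apply: Ww.
have W1 k : 1 \in W k by have := Ww k [::]; rewrite /word big_nil.
have WX k l r : lab k l ^+ r \in W k.
  by elim: r => [|r IHr]; rewrite ?expr0 ?W1 // exprS WM.
rewrite -[zspan _]/(W n); elim: n g => [|n IHn] g.
  have [p ->] := slot0_onto g; move: p {g}; apply: pol2_ind => [|a b ha hb|i j c].
  - by rewrite raddf0 rpred0.
  - by rewrite raddfB rpredB.
  rewrite /pmon !rmorphM !rmorphXn -[c]intz !rmorph_int mulrzr rpredMz //.
  exact: (WM _ _ _ (WX 0 (false, None) i) (WX 0 (true, None) j)).
move: g; apply: smon_ind => [|a b ha hb|i j c]; first exact: rpred0.
  exact: rpredB.
apply: (WM _ _ _ (WM _ _ _ (WX n.+1 (false, None) i) (WX n.+1 (true, None) j))).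
move: c (IHn c); apply: zspan_ind => [|a b ha hb|a /asboolP[w ->]].
- by rewrite raddf0 rpred0.
- by rewrite raddfB rpredB.
rewrite /word; elim: w => [|[b o] w IHw]; first by rewrite big_nil rmorph1 W1.
rewrite big_cons rmorphM /=; apply: (WM _ _ _ _ IHw).
case: o => [k|].
  suff -> : semb (lab n (b, Some k)) = lab n.+1 (b, Some k.+1) by apply: Wl.
  by rewrite /lab raddfB.
have -> : semb (lab n (b, None)) = lab n.+1 (b, Some 0) + lab n.+1 (b, None).
  by rewrite /lab /= coord0 subrK coordS coord0.
by apply: rpredD; apply: Wl.
Qed.

End Coordinates.
Arguments wspan n d p : clear implicits.
Arguments scoord : simpl never.

(** * Words killed by iterated commutators *)
Section Killing.
Variables (A : pzRingType) (x y : A).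
Hypothesis gen : generated x y.
Local Notation T := (@T A x y _).
Local Notation ev := (@ev A x y).
Local Notation Tker n := (@Tker A x y n).

Definition pvar (b : bool) : pol := if b then pY int else pX int.

Lemma sinc_pvar n b : sinc n (pvar b) = base n.+1 b.
Proof. by case: b; rewrite /= ?sinc_X ?sinc_Y. Qed.

Lemma lab_local3 n i b1 b2 b3 g : (i.+1 < n)%N ->
  lab n (b1, Some i) * lab n (b2, Some i) * lab n (b3, Some i) * g \in Tker n.
Proof.
elim: n i g => // n IHn [|i] g ni.
  case: n ni {IHn} g => // n _ g.
  have labE b : lab n.+2 (b, Some 0) = - (in1 n (pvar b) - in2 n (pvar b)).
    by rewrite opprB /in1 /in2 !sinc_pvar.
  rewrite !labE !(mulNr, mulrN) !rpredN.
  exact: local3.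
have labE b : lab n.+1 (b, Some i.+1) = semb (lab n (b, Some i)).
  by rewrite /lab raddfB.
rewrite !labE -!rmorphM; apply: Tker_emb => c; exact: IHn.
Qed.

Lemma lab_local2 n b1 b2 g :
  lab n.+1 (b1, Some n) * lab n.+1 (b2, Some n) * g \in Tker n.+1.
Proof.
elim: n g => [|n IHn] g.
  have labE b : lab 1 (b, Some 0) = - (sinc 0 (pvar b) - semb (slot0 (pvar b))).
    by rewrite opprB sinc_pvar.
  by rewrite !labE !(mulNr, mulrN) !rpredN; apply: local2.
have labE b : lab n.+2 (b, Some n.+1) = semb (lab n.+1 (b, Some n)).
  by rewrite /lab raddfB.
rewrite !labE -!rmorphM; apply: Tker_emb => c; exact: IHn.
Qed.

Lemma lab_out n b i : (n <= i)%N -> lab n (b, Some i) = 0.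
Proof.
suff h : (n <= i)%N -> scoord n b i.+1 = scoord n b i by move=> ni; rewrite /lab /= h ?subrr.
by elim: n i => [|n IHn] [|i] ni //; rewrite !coordS IHn.
Qed.

Lemma order_sum n w : (forall l i, l \in w -> l.2 = Some i -> (i < n)%N) ->
  worder w = (\sum_(i < n) count (fun l : label => l.2 == Some (val i)) w)%N.
Proof.
elim: w => [|l w IHw] wn /=; first by rewrite big1.
rewrite big_split /= -IHw => [|k i kw]; last by apply: wn; rewrite inE kw orbT.
congr (_ + _)%N; have := wn l _ (mem_head _ _); case: (l.2) => [i /(_ i erefl) ni|_] /=.
  rewrite (bigD1 (Ordinal ni)) //= eqxx big1 // => j ji.
  by case: eqP => // -[ij]; case/eqP: ji; apply/val_inj.
by rewrite big1.
Qed.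

(** Among the n places where a difference can be taken, the last one bears at
    most one difference and the others at most two: 2n - 1 in all. *)
Lemma order_Tker n w : (0 < n)%N -> (2 * n <= worder w)%N -> word n w \in Tker n.
Proof.
case: n => // n _ wn.
case: (boolP (all (fun l : label => if l.2 is Some i then i < n.+1 else true)%N w)); last first.
  move=> /allPn[[b [i|]] lw] //; rewrite -leqNgt => ni.
  by rewrite (word_rem _ lw) lab_out ?mul0r ?rpred0.
move=> /allP win.
have wS : forall l i, l \in w -> l.2 = Some i -> (i < n.+1)%N.
  by move=> l i /win; case: (l.2) => // j jn [<-].
rewrite (order_sum wS) big_ord_recr /= in wn.
set cl := fun i => count (fun l : label => l.2 == Some i) w in wn *.
have [c2|c2] := leqP 2 (cl n).
  have [[b1 o1] [[b2 o2] [w' [/eqP /= h1 /eqP /= h2 _ ->]]]] := word_count2 n.+1 c2.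
  rewrite h1 h2; exact: lab_local2.
case: (boolP [exists i : 'I_n, 3 <= cl i]%N) => [/existsP[i ci]|].
  have [[b1 o1] [[b2 o2] [[b3 o3] [w' [/eqP /= h1 /eqP /= h2 /eqP /= h3 ->]]]]] := word_count3 n.+1 ci.
  by rewrite h1 h2 h3; apply: lab_local3; rewrite ltnS ltn_ord.
rewrite negb_exists => /forallP c3.
have : (\sum_(i < n) cl i <= \sum_(i < n) 2)%N.
  by apply: leq_sum => i _; have := c3 i; rewrite -ltnNge.
rewrite sum_nat_const card_ord => h.
have : (2 * n.+1 <= n * 2 + cl n)%N by apply: leq_trans wn _; rewrite leq_add2r.
by move: c2; lia.
Qed.

Section Truncation.
Variable m : nat.
Hypothesis xm : x ^+ m = 0.

Lemma ev_xm p : ev (pX int ^+ m * p) = 0.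
Proof.
move: p; apply: pol2_ind => [|a b ha hb|i j c].
- by rewrite mulr0 raddf0.
- by rewrite mulrBr raddfB /= ha hb subrr.
have -> : pX int ^+ m * pmon i j c = pmon (m + i) j c by rewrite /pmon exprD !mulrA.
by rewrite ev_mon /mono exprD xm !mul0r mul0rz.
Qed.

Lemma coord_xm n i g : scoord n false i ^+ m * g \in Tker n.
Proof.
elim: n i g => [|n IHn] i g.
  have [p ->] := slot0_onto g.
  by rewrite coord_last -rmorphXn -rmorphM TkerE T_slot0 ev_xm rpred0.
case: i => [|i]; last by rewrite coordS -rmorphXn; apply: Tker_emb => c; apply: IHn.
move: g; apply: slots_ind => [|a b ha hb|p c].
- by rewrite mulr0 rpred0.
- by rewrite mulrBr rpredB.
have -> : scoord n.+1 false 0 = sinc n (pX int) by rewrite sinc_X.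
by rewrite mulrA -rmorphXn -rmorphM TkerE T_inc ev_xm ring_comm0l rpred0.
Qed.

End Truncation.

Lemma mono_comm b i j k l :
  (if b then i = 0 else j = 0)%N -> (if b then k = 0 else l = 0)%N ->
  ⟦mono x y i j, mono x y k l⟧ = 0.
Proof.
by case: b => -> ->; rewrite /mono /ring_comm !expr0 ?mul1r ?mulr1 -!exprD addnC subrr.
Qed.

(** All entries of the commutator are powers of the same generator. *)
Lemma T_cword_pure n b s : (0 < n)%N -> all (fun c => c.1 == b) s -> T (cword n s) = 0.
Proof.
case: n => // n _ sb.
have [i [j [s' [_ -> h1 h2 _]]]] := cwordS n s.
have {}h1 : all (fun c => c.1 == b) s'.
  by apply: h1; apply: sub_all sb => c ->; rewrite orbT.
have {}h2 := h2 b sb.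
suff h : T (cword n s') = 0 \/
    exists k l, (if b then k = 0 else l = 0)%N /\ T (cword n s') = mono x y k l.
  by rewrite T_mon; case: h => [->|[k [l [kl ->]]]]; rewrite ?ring_comm0r // (mono_comm h2 kl).
elim: n s' h1 => [|n IHn] s' h1.
  right; have [k [l [_ -> kl]]] := cword0 s'; exists k, l; split; first exact: kl.
  by rewrite T_slot0 ev_mon.
left; have [k [l [s'' [_ -> h3 h4 _]]]] := cwordS n s'.
rewrite T_mon; case: (IHn s'') => [|->|[k' [l' [kl' ->]]]]; rewrite ?ring_comm0r //.
  by apply: h3; apply: sub_all h1 => c ->; rewrite orbT.
exact: mono_comm (h4 b h1) kl'.
Qed.

(** All entries after the first are powers of the same generator. *)
Lemma T_cword_mixed n b s : (1 < n)%N ->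
  all (fun c => (c.2 == 0) || (c.1 == b)) s -> T (cword n s) = 0.
Proof.
case: n => [|[|n]] // _ sb; have [i [j [s' [_ -> h1 _ _]]]] := cwordS n.+1 s.
by rewrite T_mon (T_cword_pure _ (h1 b sb)) // ring_comm0r.
Qed.

(** All entries after the first are equal to 1. *)
Lemma T_cword_first n s : (0 < n)%N -> all (fun c => c.2 == 0) s -> T (cword n s) = 0.
Proof.
case: n => [|n] // _ sb; have [i [j [s' [_ -> _ _ /(_ sb) ->]]]] := cwordS n s.
rewrite T_mon; case: n => [|n]; last first.
  by rewrite (@T_cword_pure _ true) // ring_comm0r.
rewrite /cword big_nil; have -> : (1 : slots 0) = slot0 1 by rewrite rmorph1.
by rewrite T_slot0 ev1 ring_commC ring_comm1l oppr0.
Qed.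

Lemma word_Tker n (C : pred (bool * nat)) w :
    (forall s, all C s -> T (cword n s) = 0) ->
    (forall l, l \in w -> if l.2 is Some i then C (l.1, i) && C (l.1, i.+1) else C (l.1, 0)) ->
  word n w \in Tker n.
Proof.
move=> CT wC; apply: (zspan_min _ (word_cword n wC)) => g /asboolP[s [_ sC ->]].
by rewrite TkerE CT // rpred0.
Qed.

Lemma word_pure n b w : (0 < n)%N -> all (fun l : label => l.1 == b) w -> word n w \in Tker n.
Proof.
move=> n0 /allP wb; apply: (@word_Tker _ (fun c => c.1 == b)).
  by move=> s; apply: T_cword_pure.
by move=> [c [i|]] /wb /= ->.
Qed.

Lemma word_mixed n b w : (1 < n)%N ->
  all (fun l : label => (l.2 == None) || (l.1 == b)) w -> word n w \in Tker n.
Proof.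
move=> n0 /allP wb; apply: (@word_Tker _ (fun c => (c.2 == 0) || (c.1 == b))).
  by move=> s; apply: T_cword_mixed.
by move=> [c [i|]] /wb /= // ->; rewrite !orbT.
Qed.

Lemma word_first n w : (0 < n)%N -> worder w = 0%N -> word n w \in Tker n.
Proof.
move=> n0 /eqP; rewrite -leqn0 leqNgt -has_count => /hasPn wb.
apply: (@word_Tker _ (fun c => c.2 == 0)); first by move=> s; apply: T_cword_first.
by move=> [c [i|]] // /wb.
Qed.

End Killing.

(** * The derivation on functions of several points *)
Section Derivation.

(** The derivation of Z[x, y] with x -> 0 and y -> y^2. *)
Definition polD : pol -> pol := pext (fun i j c => pmon i j.+1 c *+ j).

Fact polD_zmod_morphism : zmod_morphism polD.
Proof. by apply: pext_zmod_morphism => i j a b; rewrite pmonB mulrnBl. Qed.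
HB.instance Definition _ := GRing.isZmodMorphism.Build pol pol polD polD_zmod_morphism.

Lemma polD_mon i j c : polD (pmon i j c) = pmon i j.+1 c *+ j.
Proof. by apply: pext_mon => k l a b; rewrite pmonB mulrnBl. Qed.

Lemma polDM p q : polD (p * q) = polD p * q + p * polD q.
Proof.
move: p q; apply: pol2_ind => [q|a b ha hb q|i j c].
- by rewrite mul0r raddf0 !mul0r addr0.
- by rewrite mulrBl !raddfB /= ha hb !mulrBl opprD addrACA.
apply: pol2_ind => [|a b ha hb|k l d].
- by rewrite mulr0 raddf0 !mulr0 addr0.
- by rewrite mulrBr !raddfB /= ha hb !mulrBr opprD addrACA.
by rewrite pmonM !polD_mon mulrnAl mulrnAr !pmonM addSn addnS -mulrnDr.
Qed.

(** The sum of the derivations polD of the slots. *)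
Fixpoint slotD n : slots n -> slots n :=
  match n with
  | 0 => fun g => slot0 (polD (unslot0 g))
  | n'.+1 => sext (fun i j c => smon i j.+1 c *+ j + smon i j (@slotD n' c))
  end.

Lemma smonB n i j (a b : slots n) : smon i j (a - b) = smon i j a - smon i j b.
Proof. by rewrite /smon raddfB mulrBr. Qed.

Lemma slotD_slot0 p : slotD (slot0 p) = slot0 (polD p).
Proof. by rewrite /= slot0K. Qed.

Lemma slotDS n :
  @slotD n.+1 = sext (fun i j c => smon i j.+1 c *+ j + smon i j (slotD c)).
Proof. by []. Qed.

Fact slotD_zmod_morphism n : zmod_morphism (@slotD n).
Proof.
elim: n => [a b|n IHn].
  have [p ->] := slot0_onto a; have [q ->] := slot0_onto b.
  by rewrite -raddfB !slotD_slot0 !raddfB.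
rewrite slotDS; apply: sextB => i j a b; rewrite smonB mulrnBl IHn smonB.
by rewrite opprD addrACA.
Qed.
Arguments slotD : simpl never.
HB.instance Definition _ n :=
  GRing.isZmodMorphism.Build (slots n) (slots n) (@slotD n) (@slotD_zmod_morphism n).

Lemma slotD_B n (a b : slots n) : slotD (a - b) = slotD a - slotD b.
Proof. exact: slotD_zmod_morphism. Qed.

Lemma slotD_mon n i j (c : slots n) :
  slotD (smon i j c) = smon i j.+1 c *+ j + smon i j (slotD c).
Proof.
rewrite slotDS sext_mon // => k l a b; rewrite raddfB !smonB mulrnBl.
by rewrite opprD addrACA.
Qed.

Lemma slotDM n (g h : slots n) : slotD (g * h) = slotD g * h + g * slotD h.
Proof.
elim: n g h => [|n IHn].
  move=> g h; have [p ->] := slot0_onto g; have [q ->] := slot0_onto h.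
  by rewrite -rmorphM !slotD_slot0 polDM raddfD /= !rmorphM.
apply: (@smon_ind _ (fun g => forall h, slotD (g * h) = slotD g * h + g * slotD h)).
- by move=> h; rewrite mul0r raddf0 !mul0r addr0.
- by move=> a b ha hb h; rewrite mulrBl !raddfB /= ha hb !mulrBl opprD addrACA.
move=> i j c; apply: smon_ind => [|a b ha hb|k l d].
- by rewrite mulr0 raddf0 !mulr0 addr0.
- by rewrite mulrBr !raddfB /= ha hb !mulrBr opprD addrACA.
rewrite smonM !slotD_mon IHn -!(mulr_natr (smon _ _ _)) natrD.
by rewrite /smon !exprS !exprD !(rmorphD, rmorphM) /=; ring.
Qed.

Lemma slotD1 n : slotD (1 : slots n) = 0.
Proof. exact: (derivation1 (@slotDM n)). Qed.

Lemma slotD_emb n (c : slots n) : slotD (semb c) = semb (slotD c).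
Proof.
have smon0 d : semb d = smon 0 0 d by rewrite /smon !expr0 !mul1r.
by rewrite smon0 slotD_mon mulr0n add0r -smon0.
Qed.

Lemma slotD_base n b : slotD (base n b) = if b then base n b ^+ 2 else 0.
Proof.
case: n => [|n].
  have -> : base 0 b = slot0 (pmon (~~ b) b 1).
    by rewrite /base /pmon rmorph1 mulr1; case: b; rewrite /= expr0 expr1 ?mulr1 ?mul1r.
  rewrite slotD_slot0 polD_mon; case: b => /=; last by rewrite mulr0n raddf0.
  by rewrite mulr1n /pmon !expr0 !expr1 !mul1r rmorph1 !mulr1 rmorphXn.
have -> : base n.+1 b = smon (~~ b) b 1.
  by rewrite /smon rmorph1 mulr1; case: b; rewrite /= expr0 expr1 ?mulr1 ?mul1r.
rewrite slotD_mon slotD1 {2}/smon raddf0 mulr0 addr0; case: b => /=; last by rewrite mulr0n.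
by rewrite /smon !expr0 !expr1 !mul1r mulr1n rmorph1 !mulr1.
Qed.

Lemma slotD_coord n b i : slotD (scoord n b i) = if b then scoord n b i ^+ 2 else 0.
Proof.
elim: n i => [|n IHn] [|i]; rewrite ?coord_last ?coord0 ?slotD_base //.
by rewrite coordS slotD_emb IHn {IHn}; case: b; rewrite ?rmorphXn ?raddf0.
Qed.

(** Differences of y count twice: y_(i+1)^2 - y_i^2 is the difference times
    y_(i+1) + y_i, and both summands equal y_1 up to differences. *)
Definition lweight (l : label) : nat := if l.1 then (isSome l.2).+1 else 0.
Definition weight (w : seq label) : nat := sumn (map lweight w).

Lemma slotD_lab n l :
  slotD (lab n l) - base n true * lab n l *+ lweight l \in wspan n 2 (isSome l.2).+1.
Proof.
case: l => -[] [i|]; rewrite /lab /lweight /=.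
- rewrite slotD_B !slotD_coord.
  have -> : scoord n true i.+1 ^+ 2 - scoord n true i ^+ 2 -
      base n true * (scoord n true i.+1 - scoord n true i) *+ 2 =
      lab n (true, Some i) *
        ((scoord n true i.+1 - base n true) + (scoord n true i - base n true)).
    by rewrite /lab /=; ring.
  apply: (wspanM (lab_wspan n (true, Some i))).
  by apply: rpredD; apply: coordB_wspan.
- by rewrite slotD_base mulr1n -expr2 subrr rpred0.
- by rewrite slotD_B !slotD_coord mulr0n !subrr rpred0.
by rewrite slotD_base mulr0n subrr rpred0.
Qed.

(** As the coordinates y of the slots agree up to differences, slotD acts on a
    word to first order as the multiplication by a multiple of y_1. *)
Lemma slotD_word n w :
  slotD (word n w) - base n true * word n w *+ weight w
    \in wspan n (size w).+1 (worder w).+1.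
Proof.
elim: w => [|l w IHw].
  by rewrite /word big_nil slotD1 /weight /= mulr0n subrr rpred0.
have -> : word n (l :: w) = lab n l * word n w by rewrite /word big_cons.
have -> : slotD (lab n l * word n w) - base n true * (lab n l * word n w) *+ weight (l :: w) =
   (slotD (lab n l) - base n true * lab n l *+ lweight l) * word n w
   + lab n l * (slotD (word n w) - base n true * word n w *+ weight w).
  rewrite slotDM /weight /= mulrnDr mulrBl mulrBr mulrnAl mulrnAr.
  by rewrite [lab n l * (_ * _)]mulrCA -!mulrA opprD addrACA.
apply: rpredD.
  exact: (wspanM (slotD_lab n l) (mem_word n erefl (leqnn (worder w)))).
have := wspanM (lab_wspan n l) IHw; congr (_ \in wspan n _ _).
by rewrite addnS.
Qed.

Variables (A : pzRingType) (x y : A) (f : {additive A -> A}).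
Hypothesis fM : derivation f.
Hypothesis fmono : forall i j, f (mono x y i j) = mono x y i j.+1 *+ j.
Local Notation T := (@T A x y _).

(** A derivation of A acts on an iterated commutator entry by entry. *)
Lemma T_slotD n (g : slots n) : T (slotD g) = f (T g).
Proof.
elim: n g => [|n IHn] g.
  have [p ->] := slot0_onto g; move: p {g}; apply: pol2_ind => [|a b ha hb|i j c].
  - by rewrite !raddf0.
  - by rewrite raddfB slotD_B !T_B raddfB ha hb.
  by rewrite slotD_slot0 polD_mon !T_slot0 raddfMn /= !ev_mon raddfMz /= fmono !pmulrn mulrzAC.
move: g; apply: smon_ind => [|a b ha hb|i j c]; first by rewrite !raddf0.
  by rewrite slotD_B !T_B raddfB ha hb.
by rewrite slotD_mon raddfD raddfMn /= !T_mon IHn (derivation_comm fM) fmono ring_commMnl.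
Qed.

End Derivation.

(** * Words as derivatives *)
Section Reduction.
Variables (A : pzRingType) (x y : A).
Hypothesis gen : generated x y.
Variable m : nat.
Hypotheses (m0 : (0 < m)%N) (xm : x ^+ m = 0).
Variables n d : nat.
Hypotheses (n0 : (0 < n)%N) (d1 : n = 1%N -> (m <= d)%N) (dn : (2 * n + m <= d + 3)%N).
Local Notation Tker := (@Tker A x y n).
Local Notation bx := (false, None : option nat).

Definition good : {pred slots n} := fun g =>
  `[< exists c h, [/\ (0 < c)%N, h \in wspan n d 0 & g *+ c - slotD h \in Tker] >].

Fact good_zmod_closed : zmod_closed good.
Proof.
split.
  by apply/asboolP; exists 1%N, 0; rewrite raddf0 subr0 mulr1n; split; rewrite ?rpred0.
move=> g1 g2 /asboolP[c1 [h1 [c10 h1S k1]]] /asboolP[c2 [h2 [c20 h2S k2]]].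
apply/asboolP; exists (c1 * c2)%N, (h1 *+ c2 - h2 *+ c1); split.
- by rewrite muln_gt0 c10.
- by rewrite rpredB ?rpredMn.
have -> : (g1 - g2) *+ (c1 * c2) - slotD (h1 *+ c2 - h2 *+ c1) =
   (g1 *+ c1 - slotD h1) *+ c2 - (g2 *+ c2 - slotD h2) *+ c1.
  rewrite slotD_B !(raddfMn (@slotD n)) /= !mulrnBl -!mulrnA (mulnC c2 c1).
  by move: (g1 *+ _) (g2 *+ _) (slotD h1 *+ c2) (slotD h2 *+ c1) => u v s t; ring.
by rewrite rpredB ?rpredMn.
Qed.
HB.instance Definition _ := GRing.isZmodClosed.Build (slots n) good good_zmod_closed.

Lemma good_div g c : (0 < c)%N -> g *+ c \in good -> g \in good.
Proof.
move=> c0 /asboolP[c' [h [c'0 hS k]]]; apply/asboolP; exists (c * c')%N, h.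
by rewrite muln_gt0 c0 mulrnA.
Qed.

Lemma good_Tker g : g \in Tker -> g \in good.
Proof.
move=> k; apply/asboolP; exists 1%N, 0; rewrite raddf0 subr0 mulr1n.
by split; rewrite ?rpred0.
Qed.

Lemma good_slotD h : h \in wspan n d 0 -> slotD h \in good.
Proof. by move=> hS; apply/asboolP; exists 1%N, h; rewrite mulr1n subrr rpred0. Qed.

Lemma size_labels w :
  size w = (count_mem bx w + count_mem (true, None) w + worder w)%N.
Proof. by elim: w => //= -[[] [i|]] w -> /=; lia. Qed.

Lemma weight_eq0 w : weight w = 0%N -> all (fun l : label => l.1 == false) w.
Proof.
rewrite /weight; elim: w => //= l w IHw /eqP; rewrite addn_eq0 => /andP[l0 /eqP/IHw->].
by move: l0; rewrite /lweight andbT; case: (l.1).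
Qed.

Lemma word_heavy w : (m <= count_mem bx w)%N -> word n w \in Tker.
Proof.
move=> mc; rewrite (word_count n bx) -(subnKC mc) exprD -mulrA.
rewrite -[lab n bx]/(base n false) -coord0; exact: coord_xm.
Qed.

Lemma pow_pair_wspan i j a b :
  scoord n false i ^+ a * scoord n false j ^+ b - base n false ^+ (a + b)
    \in wspan n (a + b) 1.
Proof.
have -> : scoord n false i ^+ a * scoord n false j ^+ b - base n false ^+ (a + b) =
    scoord n false i ^+ a * (scoord n false j ^+ b - base n false ^+ b)
    + (scoord n false i ^+ a - base n false ^+ a) * base n false ^+ b.
  by rewrite exprD; ring.
apply: rpredD; first exact: (wspanM (coordX_wspan n false i a) (coordXB_wspan n false j b)).
exact: (wspanM (coordXB_wspan n false i a) (baseX_wspan n false b)).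
Qed.

Lemma perm_extract (l : label) c w : (c <= count_mem l w)%N ->
  exists w', perm_eq w (nseq c l ++ w').
Proof.
move=> cw; exists (nseq (count_mem l w - c) l ++ [seq k <- w | k != l]).
rewrite catA -nseqD subnKC // perm_sym.
have -> : nseq (count_mem l w) l = filter (pred1 l) w.
  by rewrite -size_filter; apply/esym/all_pred1P/filter_all.
exact/permPl/perm_filterC.
Qed.

Lemma word_perm w w' : perm_eq w w' -> word n w = word n w'.
Proof. exact: perm_big. Qed.

Lemma word_nseq c l : word n (nseq c l) = lab n l ^+ c.
Proof. by elim: c => [|c IHc]; rewrite /word /= ?big_nil // big_cons exprS -IHc. Qed.

(** Both x_(i+1)^m and x_i^m are killed, hence so is their difference, which is
    (x_(i+1) - x_i) times the sum of the x_(i+1)^(m-1-j) x_i^j. Up to more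
    differences, that sum is m x_1^(m-1). *)
Lemma word_rel i w : (m.-1 <= count_mem bx w)%N -> (false, Some i) \in w ->
    {subset wspan n (size w) (worder w).+1 <= good} ->
  word n w \in good.
Proof.
move=> mc iw IH; apply: (good_div m0).
have [v wv] := perm_extract mc.
have iv : (false, Some i) \in v.
  by move: iw; rewrite (perm_mem wv) mem_cat mem_nseq andbF.
pose w' := rem (false, Some i) v; set dl := lab n (false, Some i).
have wE : word n w = base n false ^+ m.-1 * dl * word n w'.
  by rewrite (word_perm wv) -wordM word_nseq (word_rem _ iv) mulrA.
have sE : size w = (1 + size w' + m.-1)%N.
  by rewrite (perm_size wv) size_cat size_nseq (perm_size (perm_to_rem iv)) addnC.
have oE : worder w = (1 + worder w')%N.
  rewrite /worder (permP wv) count_cat count_nseq mul0n.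
  by rewrite (permP (perm_to_rem iv)).
pose c1 := scoord n false i.+1; pose c0 := scoord n false i.
pose rest := \sum_(j < m) (c1 ^+ (m.-1 - j) * c0 ^+ j - base n false ^+ m.-1).
have -> : word n w *+ m = (c1 ^+ m - c0 ^+ m) * word n w' - dl * word n w' * rest.
  rewrite /rest sumrB sumr_const card_ord subrXX.
  by rewrite wE -[c1 - c0]/dl; set S := \sum_(_ < m) _; ring.
apply: rpredB.
  by rewrite mulrBl; apply: good_Tker; rewrite rpredB ?coord_xm.
have h1 := wspanM (lab_wspan n (false, Some i))
  (mem_word n (erefl (size w')) (leqnn (worder w'))).
suff h2 : rest \in wspan n m.-1 1.
  by apply: IH; rewrite sE oE; have := wspanM h1 h2; rewrite addn1.
apply: rpred_sum => j _.
have jE : m.-1 = (m.-1 - j + j)%N by move: (ltn_ord j) m0; lia.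
by have := pow_pair_wspan i.+1 i (m.-1 - j) j; rewrite -jE.
Qed.

(** Descending induction on the number p of differences in a word w of degree
    d + 1, starting from order_Tker. If w contains y_1, and what remains after
    removing it has positive weight, slotD_word shows that w is a derivative to
    first order. If w contains no y_1, it has d + 1 - p >= m - 1 factors x_1,
    because p < 2n and d >= 2n + m - 3; then word_rel applies as soon as w
    contains a difference of x. The words that are left have, after the first
    entry, powers of a single generator. The case n = 1, where that last
    argument fails when w contains y_1, is settled by word_rel and d >= m. *)
Theorem wspan_good : {subset wspan n d.+1 0 <= good}.
Proof.
suff: forall r p, (2 * n <= p + r)%N -> {subset wspan n d.+1 p <= good}.
  by move=> /(_ (2 * n)%N 0%N); apply.
elim=> [|r IHr] p pr; apply: wspan_min => w sw pw.
  by apply/good_Tker/order_Tker => //; lia.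
have IH : {subset wspan n d.+1 p.+1 <= good} by apply: IHr; lia.
have [pw'|wp] := ltnP p (worder w); first by apply: IH; apply: mem_word.
have {wp} pE : worder w = p by apply/eqP; rewrite eqn_leq wp pw.
have [big|small] := leqP (2 * n) p.
  by apply/good_Tker/order_Tker => //; lia.
have rel i : (m.-1 <= count_mem bx w)%N -> (false, Some i) \in w -> word n w \in good.
  by move=> mc iw; apply: (word_rel mc iw); rewrite sw pE.
have sl := size_labels w.
have [heavy|light] := leqP m (count_mem bx w); first exact/good_Tker/word_heavy.
case: (boolP ((true, None) \in w)) => [yw|yw].
  (* Removing one factor y_1 from w leaves a word whose derivative is, to first
     order, a multiple of w. *)
  pose w' := rem (true, None : option nat) w.
  have wE : word n w = base n true * word n w' by rewrite (word_rem n yw).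
  have pww' := perm_to_rem yw.
  have sw' : size w' = d by move: (perm_size pww'); rewrite sw => -[].
  have ow' : worder w' = p by rewrite -pE /worder (permP pww').
  have [w0|w0] := eqVneq (weight w') 0%N; last first.
    have c0 : (0 < weight w')%N by rewrite lt0n.
    apply: (good_div c0).
    have -> : word n w *+ weight w' = slotD (word n w')
       - (slotD (word n w') - base n true * word n w' *+ weight w').
      by rewrite subKr wE.
    apply: rpredB; first by apply: good_slotD; apply: mem_word.
    by apply: IH; have := slotD_word n w'; rewrite sw' ow'.
  have /allP w'x := weight_eq0 w0.
  have [n1|n1] := leqP n 1; last first.
    apply: good_Tker; apply: (@word_mixed _ _ _ _ false) => //.
    apply/allP => l; rewrite (perm_mem pww') inE => /orP[/eqP->//|/w'x ->].
    by rewrite orbT.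
  have nE : n = 1%N by lia.
  have [p0|p0] := posnP p.
    by apply: good_Tker; apply: word_first => //; rewrite pE p0.
  have : has (fun l : label => isSome l.2) w' by rewrite has_count -/(worder w') ow'.
  case/hasP=> -[b [i|]] // iw' _; have /= /eqP b0 := w'x _ iw'.
  have iw : (false, Some i) \in w by rewrite (perm_mem pww') inE -b0 iw' orbT.
  apply: rel iw; have := size_labels w'.
  have -> : count_mem (true, None) w' = 0%N.
    by apply/count_memPn; apply/negP => /w'x.
  rewrite sw' ow' (permP pww') /=; have := d1 nE.
  by move: small; rewrite nE -/w'; lia.
case: (boolP (has (fun l : label => (l.1 == true)) w)) => [/hasP[[b [i|]] /= iw /eqP bE]|nty]; last first.
- apply: good_Tker; apply: (@word_pure _ _ _ _ false) => //.
  apply/allP => -[[] o] lw //=; move/hasPn/(_ _ lw): nty; by [].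
- by move: yw; rewrite -bE iw.
have y0 : count_mem (true, None : option nat) w = 0%N by apply/count_memPn.
rewrite sw y0 addn0 pE in sl.
have [n1|n1] := leqP n 1.
  have nE : n = 1%N by lia.
  by exfalso; have := d1 nE; move: small light sl; rewrite nE; lia.
case: (boolP (has (fun l : label => (l.1 == false) && isSome l.2) w)).
  move=> /hasP[[c o] jw /= /andP[/eqP c0]]; rewrite {}c0 in jw *.
  by case: o jw => // j jw _; apply: (rel j) => //; lia.
move=> /hasPn nx; apply: good_Tker; apply: (@word_mixed _ _ _ _ true) => //.
by apply/allP => -[[] [j|]] lw //; have := nx _ lw.
Qed.

End Reduction.

(** * Injectivity of the derivation *)
Section WeightOperator.
Variables (A : pzRingType) (E : {additive A -> A}).

(** The product of the operators E - b for b in s. *)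
Fixpoint kill (s : seq nat) (a : A) : A :=
  if s is b :: s' then kill s' (E a - a *+ b) else a.

Lemma killB s a b : kill s (a - b) = kill s a - kill s b.
Proof.
elim: s a b => //= c s IHs a b; rewrite -IHs raddfB mulrnBl.
by congr kill; rewrite /=; ncring.
Qed.

Lemma kill0 s : kill s 0 = 0.
Proof. by rewrite -[in LHS](subrr 0) killB subrr. Qed.

Lemma kill_cat s t a : kill (s ++ t) a = kill t (kill s a).
Proof. by elim: s a => //= b s IHs a. Qed.

Lemma kill_step b s a : kill s (E a - a *+ b) = E (kill s a) - kill s a *+ b.
Proof.
elim: s a => //= c s IHs a; rewrite -IHs; congr kill.
by rewrite !(raddfB E) !(raddfMn E) /= !mulrnBl mulrnAC; ncring.
Qed.

Lemma killC s t a : kill s (kill t a) = kill t (kill s a).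
Proof. by elim: s a => //= b s IHs a; rewrite -kill_step IHs. Qed.

Lemma kill_mem (U : zmodClosed A) s a :
  (forall a, a \in U -> E a \in U) -> a \in U -> kill s a \in U.
Proof. by move=> EU; elim: s a => //= b s IHs a aU; rewrite IHs // rpredB ?rpredMn ?EU. Qed.

Lemma kill_eigen (U : zmodClosed A) (z : int) s a :
    (forall a, a \in U -> E a \in U) -> E a - a *~ z \in U ->
  kill s a - a *~ (\prod_(b <- s) (z - b%:Z)) \in U.
Proof.
move=> EU Ea; elim: s => [|b s IHs]; first by rewrite big_nil mulr1z subrr rpred0.
rewrite big_cons /= kill_step; set p := \prod_(_ <- s) _.
have -> : E (kill s a) - kill s a *+ b - a *~ ((z - b%:Z) * p) =
    E (kill s a - a *~ p) - (kill s a - a *~ p) *+ b + (E a - a *~ z) *~ p.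
  rewrite raddfB raddfMz /= mulrnBl !mulrzBl mulrBl mulrzBr -!mulrzA.
  have -> : a *~ p *+ b = a *~ (b%:Z * p) by rewrite pmulrn -mulrzA mulrC.
  by ncring.
apply: rpredD; last exact: rpredMz.
by apply: rpredB; [apply: EU | apply: rpredMn].
Qed.

End WeightOperator.

Section Injectivity.
Variables (A : pzRingType) (x y : A).
Hypothesis gen : generated x y.
Variables (e f E : {additive A -> A}).
Hypotheses (eM : derivation e) (fM : derivation f) (EM : derivation E).
Hypotheses (ex : e x = 0) (ey : e y = 1) (fx : f x = 0) (fy : f y = y ^+ 2).
Hypotheses (Ex : E x = 0) (Ey : E y = y).

(** The derivations e, f and E span a copy of sl_2. *)
Lemma ef_bracket a : e (f a) = f (e a) + E a *+ 2.
Proof.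
move: a; apply: gen.
- by rewrite !derivation1 // !raddf0 mul0rn addr0.
- by rewrite fx ex Ex !raddf0 mul0rn addr0.
- by rewrite fy ey Ey derivation1 // exprS expr1 eM ey; ncring.
- by move=> a b ha hb; rewrite !raddfB /= ha hb; ncring.
by move=> a b ha hb; rewrite fM eM EM !raddfD /= !(eM, fM) ha hb; ncring.
Qed.

Lemma Ef_bracket a : E (f a) = f (E a) + f a.
Proof.
move: a; apply: gen.
- by rewrite !derivation1 // !raddf0 addr0.
- by rewrite fx Ex !raddf0 addr0.
- by rewrite fy Ey fy exprS expr1 EM Ey.
- by move=> a b ha hb; rewrite !raddfB /= ha hb; ncring.
by move=> a b ha hb; rewrite fM EM !raddfD /= !(EM, fM) ha hb; ncring.
Qed.

Lemma Ee_bracket a : E (e a) = e (E a) - e a.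
Proof.
move: a; apply: gen.
- by rewrite !derivation1 // !raddf0 addr0.
- by rewrite ex Ex !raddf0 addr0.
- by rewrite ey Ey ey derivation1 // subrr.
- by move=> a b ha hb; rewrite !raddfB /= ha hb; ncring.
by move=> a b ha hb; rewrite eM EM !raddfD /= !(EM, eM) ha hb; ncring.
Qed.

(** Weight vectors that span A; the only ones of weight zero are the powers of
    x. *)
Definition wvec : {pred A} := fun a =>
  `[< (exists i, a = x ^+ i) \/ exists2 b, (0 < b)%N & E a = a *+ b >].

Lemma wvec_span a : a \in zspan wvec.
Proof.
have w_mem c : c \in wvec -> c \in zspan wvec by apply: mem_zspan.
move: a; apply: gen.
- by apply/w_mem/asboolP; left; exists 0%N; rewrite expr0.
- by apply/w_mem/asboolP; left; exists 1%N; rewrite expr1.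
- by apply/w_mem/asboolP; right; exists 1%N; rewrite // mulr1n Ey.
- by move=> a b ha hb; rewrite rpredB.
have EX i : E (x ^+ i) = 0 by apply: derivationX0.
move=> a b; apply: (@zspanM _ wvec wvec wvec) => {a b} a b.
move=> /asboolP[[i ->]|[p p0 Ea]] /asboolP[[j ->]|[q q0 Eb]]; apply/w_mem/asboolP.
- by left; exists (i + j)%N; rewrite exprD.
- by right; exists q; rewrite // EM EX Eb mul0r add0r mulrnAr.
- by right; exists p; rewrite // EM EX Ea mulr0 addr0 mulrnAl.
by right; exists (p + q)%N; rewrite ?addn_gt0 ?p0 // EM Ea Eb mulrnAl mulrnAr mulrnDr.
Qed.

Definition pvec : {pred A} := fun a => `[< exists2 b, (0 < b)%N & E a = a *+ b >].

(** Powers of x commute, so that a commutator has no component of weight 0. *)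
Lemma lcs_pvec k a : (1 < k)%N -> a \in lcs A k -> a \in zspan pvec.
Proof.
have EX i : E (x ^+ i) = 0 by apply: derivationX0.
have wp w v : w \in wvec -> v \in pvec -> ⟦w, v⟧ \in pvec.
  move=> /asboolP[[i ->]|[p p0 Ea]] /asboolP[q q0 Eb]; apply/asboolP.
    by exists q; rewrite // derivation_comm // EX Eb ring_comm0l add0r ring_commMnr.
  exists (p + q)%N; rewrite ?addn_gt0 ?p0 // derivation_comm // Ea Eb.
  by rewrite ring_commMnl ring_commMnr mulrnDr.
have bil P b : (forall w, w \in wvec -> forall v, v \in P -> ⟦w, v⟧ \in zspan pvec) ->
    b \in zspan P -> forall c, ⟦c, b⟧ \in zspan pvec.
  move=> wP bP c; move: c (wvec_span c); apply: zspan_ind => [|c c' h h'|c cw].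
  - by rewrite ring_comm0l rpred0.
  - by rewrite ring_commBl rpredB.
  move: b bP; apply: zspan_ind => [|v v' h h'|v vP]; last exact: wP.
    by rewrite ring_comm0r rpred0.
  by rewrite ring_commBr rpredB.
case: k => [|[|k]] // _; elim: k a => [|k IHk]; apply: lcs_ind => //.
- exact: rpred0.
- by move=> a b; apply: rpredB.
- move=> a b _; apply: (@bil wvec) (wvec_span b) _ => w ww v vw.
  case/asboolP: (ww) => [[i wi]|wp'].
    move: vw => /asboolP[[j vj]|vp]; last first.
      by apply: mem_zspan; apply: wp => //; apply/asboolP.
    by rewrite wi vj /ring_comm -!exprD addnC subrr rpred0.
  by rewrite ring_commC rpredN; apply: mem_zspan; apply: wp => //; apply/asboolP.
- exact: rpred0.
- by move=> a b; apply: rpredB.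
move=> a b bL; apply: (@bil pvec) (IHk _ bL) _ => w ww v vp.
by apply: mem_zspan; apply: wp.
Qed.

Lemma pvec_kill a : a \in zspan pvec -> exists2 s, all (leq 1) s & kill E s a = 0.
Proof.
move: a; apply: zspan_ind => [|a b [s s0 sa] [t t0 tb]|a /asboolP[b b0 Ea]].
- by exists [::].
- exists (s ++ t); first by rewrite all_cat s0.
  by rewrite killB !kill_cat sa kill0 sub0r killC tb kill0 oppr0.
by exists [:: b]; rewrite /= ?b0 // Ea subrr.
Qed.

Lemma kill_all a : exists s, kill E s a = 0.
Proof.
move: a (wvec_span a); apply: zspan_ind => [|a b [s sa] [t tb]|a].
- by exists [::].
- by exists (s ++ t); rewrite killB !kill_cat sa kill0 sub0r killC tb kill0 oppr0.
case/asboolP=> [[i ->]|[b b0 Ea]]; last by exists [:: b]; rewrite /= Ea subrr.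
by exists [:: 0%N]; rewrite /= derivationX0 // subrr.
Qed.

Section Modulo.
Variable U : zmodClosed A.
Hypothesis Udiv : forall a (z : int), z != 0 -> a *~ z \in U -> a \in U.
Hypotheses (eU : forall a, a \in U -> e a \in U) (fU : forall a, a \in U -> f a \in U).
Hypothesis EU : forall a, a \in U -> E a \in U.

(** E has no negative weights on A, in particular not -1. *)
Lemma negative_weight a : E a + a \in U -> a \in U.
Proof.
move=> Ea; have [s sa] := kill_all a.
have {}Ea : E a - a *~ -1 \in U by rewrite mulrNz mulr1z opprK.
have := kill_eigen s EU Ea; rewrite sa sub0r rpredN; apply: Udiv.
by rewrite prodf_seq_neq0; apply/allP => b _ /=; lia.
Qed.

(** The relation f (e^(j+1) a) = - (j + 1) (2b - j) e^j a holds modulo U and the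
    images of f a. Since e^(b+1) a has weight -1, it vanishes, and for j <= b
    the coefficient is not zero, so that descending induction on j gives
    a = 0 modulo U. *)
Lemma eigen_inj a b : (0 < b)%N -> E a - a *+ b \in U -> f a \in U -> a \in U.
Proof.
move=> b0 Ea fa; pose u j := iter j e a.
have Eu j : E (u j) - u j *~ (b%:Z - j%:Z) \in U.
  elim: j => [|j IHj]; first by rewrite subr0 -pmulrn.
  have -> : E (u j.+1) - u j.+1 *~ (b%:Z - j.+1%:Z) = e (E (u j) - u j *~ (b%:Z - j%:Z)).
    rewrite -[u j.+1]/(e (u j)) (_ : b%:Z - j.+1%:Z = b%:Z - j%:Z - 1); last by lia.
    by rewrite (mulrzBr _ _ 1) mulr1z Ee_bracket (raddfB e) (raddfMz e) /=; ncring.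
  exact: eU.
have fu j : f (u j.+1) + u j *~ ((j%:Z + 1) * (b%:Z * 2 - j%:Z)) \in U.
  elim: j => [|j IHj].
    have -> : f (u 1%N) + u 0%N *~ ((0 + 1) * (b%:Z * 2 - 0)) =
        e (f a) - (E a - a *~ b%:Z) *+ 2.
      rewrite [u _]/= ef_bracket add0r mul1r subr0 mulrzA mulrz_nat.
      by ncring.
    by apply: rpredB; [exact: eU | apply: rpredMn; rewrite -pmulrn].
  have -> : f (u j.+2) + u j.+1 *~ ((j.+1%:Z + 1) * (b%:Z * 2 - j.+1%:Z)) =
      e (f (u j.+1) + u j *~ ((j%:Z + 1) * (b%:Z * 2 - j%:Z)))
      - (E (u j.+1) - u j.+1 *~ (b%:Z - j.+1%:Z)) *+ 2.
    rewrite [u j.+2]/= -/(u j.+1) (raddfD e) (raddfMz e) /= ef_bracket -[e (u j)]/(u j.+1).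
    have -> : ((j.+1%:Z + 1) * (b%:Z * 2 - j.+1%:Z)) =
      (j%:Z + 1) * (b%:Z * 2 - j%:Z) + (b%:Z - j.+1%:Z) * 2 by lia.
    by set z := b%:Z - j.+1%:Z; rewrite mulrzDr (mulrzA _ z 2) mulrz_nat; ncring.
  by rewrite rpredB ?rpredMn ?eU.
have ub : u b.+1 \in U.
  apply: negative_weight; have := Eu b.+1.
  by rewrite -addn1 PoszD opprD addrA subrr sub0r mulrNz mulr1z opprK.
suff h j : (j <= b.+1)%N -> u (b.+1 - j)%N \in U by have := h b.+1 (leqnn _); rewrite subnn.
elim: j => [|j IHj] jb; first by rewrite subn0.
have := fu (b.+1 - j.+1)%N; rewrite -subSn // subSS rpredDl ?fU ?IHj 1?ltnW //.
by apply: Udiv; apply: mulf_neq0; lia.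
Qed.

(** An element of L_k is annihilated by a product of operators E - b with b > 0;
    they are removed one at a time, by eigen_inj. *)
Lemma f_inj k a : (1 < k)%N -> a \in lcs A k -> f a \in U -> a \in U.
Proof.
move=> k1 aL; have [s s0 sa] := pvec_kill (lcs_pvec k1 aL).
have {}sa : kill E s a \in U by rewrite sa rpred0.
elim: s s0 a {aL} sa => [|b s IHs] //= /andP[b0 s0] a sa fa.
apply: (eigen_inj b0) => //; apply: (IHs s0) => //.
have -> : f (E a - a *+ b) = E (f a) - f a - f a *+ b.
  by rewrite raddfB raddfMn /= Ef_bracket; ncring.
by rewrite !rpredB ?rpredMn ?EU.
Qed.

End Modulo.

End Injectivity.

(** * Surjectivity of the derivation up to torsion *)
Section Surjectivity.
Variables (A : pzRingType) (x y : A).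
Hypothesis gen : generated x y.
Variable Adeg : nat -> zmodClosed A.
Hypotheses (deg1 : 1 \in Adeg 0) (degx : x \in Adeg 1) (degy : y \in Adeg 1).
Hypothesis degM : forall i j a b, a \in Adeg i -> b \in Adeg j -> a * b \in Adeg (i + j).
Variables (f Et : {additive A -> A}).
Hypotheses (fM : derivation f) (EtM : derivation Et).
Hypotheses (fx : f x = 0) (fy : f y = y ^+ 2).
Hypothesis Et_deg : forall d a, a \in Adeg d -> Et a = a *+ d.
Local Notation T := (@T A x y _).

Lemma T_Mz n (g : slots n) z : T (g *~ z) = T g *~ z.
Proof. exact: raddfMz. Qed.
Lemma T_Mn n (g : slots n) z : T (g *+ z) = T g *+ z.
Proof. exact: raddfMn. Qed.

Lemma f_mono i j : f (mono x y i j) = mono x y i j.+1 *+ j.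
Proof.
rewrite /mono fM (derivationX0 fM) // mul0r add0r -mulrnAr; congr (_ * _).
elim: j => [|j IHj]; first by rewrite expr0 derivation1 // mulr0n.
by rewrite exprS fM IHj fy mulrnAr -!exprS -exprD mulrS.
Qed.

Lemma mono_deg i j : mono x y i j \in Adeg (i + j).
Proof.
have degX z r : z \in Adeg 1 -> z ^+ r \in Adeg r.
  by move=> z1; elim: r => [|r IHr]; rewrite ?expr0 // exprS -add1n degM.
by rewrite /mono degM ?degX.
Qed.

Lemma T_cword_deg n s : T (cword n s) \in Adeg (size s).
Proof.
elim: n s => [|n IHn] s.
  have [i [j [<- -> _]]] := cword0 s.
  by rewrite T_slot0 ev_mon mulr1z mono_deg.
have [i [j [s' [<- -> _ _ _]]]] := cwordS n s; rewrite T_mon /ring_comm.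
apply: rpredB; first by apply: degM; rewrite ?mono_deg.
by rewrite addnC; apply: degM; rewrite ?mono_deg.
Qed.

Lemma T_wspan_deg n d g : g \in wspan n d 0 -> T g \in Adeg d.
Proof.
move: g; apply: zspan_ind => [|a b ha hb|a /asboolP[w [<- _ ->]]].
- by rewrite T_0 rpred0.
- by rewrite T_B rpredB.
suff: word n w \in zspan (fun g => `[< exists s, size s = size w /\ g = cword n s >]).
  move: (word n w); apply: zspan_ind => [|g h hg hh|g /asboolP[s [<- ->]]].
  - by rewrite T_0 rpred0.
  - by rewrite T_B rpredB.
  exact: T_cword_deg.
have wT l : l \in w -> if l.2 is Some i then predT (l.1, i) && predT (l.1, i.+1) else predT (l.1, 0%N).
  by case: (l.2).
apply: zspan_min (word_cword n wT) => g /asboolP[s [sw _ ->]].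
by apply: mem_zspan; apply/asboolP; exists s.
Qed.

Lemma kill_deg s d a : a \in Adeg d -> kill Et s a = a *~ \prod_(b <- s) (d%:Z - b%:Z).
Proof.
move=> /Et_deg Ea; elim: s => [|b s IHs]; first by rewrite big_nil mulr1z.
rewrite big_cons /= kill_step IHs raddfMz /= Ea; set p := \prod_(_ <- s) _.
by rewrite !pmulrn -!mulrzA -mulrzBr mulrBl (mulrC p).
Qed.

(** Projecting to degree d would need division; the product of Et - b over the
    other degrees b does it up to a nonzero integer. *)
Lemma T_component n d (g : slots n) : exists s g',
  [/\ d \notin s, g' \in wspan n d 0 & kill Et s (T g) = T g'].
Proof.
move: g (word_span g); apply: zspan_ind => [|a b [s [a' [ds aS aE]]] [t [b' [dt bS bE]]]|g].
- by exists [::], 0; split; rewrite // rpred0.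
- pose za := \prod_(c <- t) (d%:Z - c%:Z); pose zb := \prod_(c <- s) (d%:Z - c%:Z).
  exists (s ++ t), (a' *~ za - b' *~ zb); split.
  + by rewrite mem_cat negb_or ds.
  + by rewrite rpredB ?rpredMz.
  rewrite !T_B !T_Mz killB !kill_cat aE killC bE.
  by rewrite (kill_deg _ (T_wspan_deg aS)) (kill_deg _ (T_wspan_deg bS)).
case/asboolP=> w ->; have wS : word n w \in wspan n (size w) 0 by apply: mem_word.
have [<-|dw] := eqVneq (size w) d; first by exists [::], (word n w).
exists [:: size w], 0; split; first by rewrite inE eq_sym.
  exact: rpred0.
by rewrite T_0 /= (Et_deg (T_wspan_deg wS)) subrr.
Qed.

Variables (m : nat).
Hypotheses (m0 : (0 < m)%N) (xm : x ^+ m = 0).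
Variables n d : nat.
Hypotheses (n0 : (0 < n)%N) (d1 : n = 1%N -> (m <= d)%N) (dn : (2 * n + m <= d + 3)%N).

(** Modulo the next term of the series u is some T g, of which only the part g'
    of degree d + 1 matters; by wspan_good g' is, up to an integer and modulo
    the kernel of T, of the form slotD h, and T (slotD h) is f (T h). *)
Theorem f_surj u : u \in lcs A n.+1 -> u \in Adeg d.+1 ->
  exists z w, [/\ z != 0 :> int, w \in lcs A n.+1, w \in Adeg d & u *~ z - f w \in lcs A n.+2].
Proof.
move=> uL ud; have [g ug] : exists g : slots n, u - T g \in slcs A n.+2.
  by case: n n0 uL => // n' _; apply: T_surj.
have [s [g' [ds g'S g'E]]] := T_component d.+1 g.
have := wspan_good gen m0 xm n0 d1 dn g'S => /asboolP[c [h [c0 hS]]].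
rewrite TkerE T_B T_Mn (T_slotD fM f_mono) => ch.
pose p := \prod_(b <- s) (d.+1%:Z - b%:Z).
have p0 : p != 0.
  rewrite prodf_seq_neq0; apply/allP => b bs /=.
  by apply: contraNneq ds => /eqP; rewrite subr_eq0 => /eqP[->].
have up : u *~ p - T g' \in slcs A n.+2.
  rewrite -(kill_deg _ ud) -g'E -killB; apply: kill_mem => // a.
  exact: derivation_slcs.
have : u *~ (p * c%:Z) - f (T h) \in slcs A n.+2.
  have -> : u *~ (p * c%:Z) - f (T h) = (u *~ p - T g') *+ c + (T g' *+ c - f (T h)).
    by rewrite mulrzA -pmulrn mulrnBl addrA subrK.
  by rewrite rpredD ?rpredMn.
move=> /mem_satP[r r0 hr]; exists (p * c%:Z * r%:Z), (T h *+ r); split.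
- apply: mulf_neq0; last by move: r0; clear; lia.
  by apply: mulf_neq0 => //; move: c0; clear; lia.
- by rewrite rpredMn // T_lcs.
- by rewrite rpredMn // T_wspan_deg.
by rewrite (mulrzA _ _ r%:Z) -[_ *~ r%:Z]pmulrn raddfMn /= -mulrnBl.
Qed.

End Surjectivity.

(** * Derivations of the truncated free ring *)

(** Derivations of the free ring only depend on its basis of words, so they are
    studied in any ring R spanned by the products of two letters. *)
Section WordAlgebra.
Variables (R : pzRingType) (letter : 'I_2 -> R) (fword : seq 'I_2 -> R).
Hypotheses (fword0 : fword [::] = 1) (fword_cons : forall i w, fword (i :: w) = letter i * fword w).
Hypothesis fword_ind : forall Q : R -> Prop,
  Q 0 -> (forall a b, Q a -> Q b -> Q (a - b)) -> (forall w, Q (fword w)) -> forall a, Q a.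

Lemma fword_cat v w : fword (v ++ w) = fword v * fword w.
Proof.
elim: v => [|i v IHv]; first by rewrite fword0 mul1r.
by rewrite cat_cons !fword_cons IHv mulrA.
Qed.

Lemma fword_gen : generated (letter 0) (letter 1).
Proof.
move=> Q Q1 Qx Qy QB QM; apply: fword_ind => //; first by rewrite -(subrr 1); apply: QB.
elim=> [|i w IHw]; first by rewrite fword0.
rewrite fword_cons; apply: QM => //.
case: i => -[|[|]] // i2.
  by have -> : Ordinal i2 = 0 by apply/val_inj.
by have -> : Ordinal i2 = 1 by apply/val_inj.
Qed.

Variables (dx dy : R).

Fixpoint der_word (w : seq 'I_2) : R :=
  if w is i :: w' then
    (if i == 0 then dx else dy) * fword w' + letter i * der_word w'
  else 0.

Variable der : {additive R -> R}.
Hypothesis der_fword : forall w, der (fword w) = der_word w.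

Lemma word_derivation : derivation der.
Proof.
move=> a b; move: a b; apply: fword_ind => [b|a a' ha ha' b|v].
- by rewrite mul0r raddf0 !mul0r addr0.
- by rewrite mulrBl !raddfB /= ha ha'; ncring.
apply: fword_ind => [|b b' hb hb'|w].
- by rewrite mulr0 raddf0 !mulr0 addr0.
- by rewrite mulrBr !raddfB /= hb hb'; ncring.
rewrite -fword_cat !der_fword; elim: v => [|i v IHv] /=.
  by rewrite fword0 mul0r mul1r add0r.
by rewrite IHv fword_cat fword_cons; ncring.
Qed.

Lemma derivation_letter i : der (letter i) = if i == 0 then dx else dy.
Proof.
have := der_fword [:: i].
by rewrite fword_cons fword0 mulr1 /= fword0 mulr0 addr0 mulr1.
Qed.

Definition wdeg d : {pred R} := zspan (fun g => `[< exists2 w, size w = d & g = fword w >]).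
HB.instance Definition _ d := GRing.isZmodClosed.Build R (wdeg d) (zspan_zmod_closed _).

Lemma fword_wdeg w : fword w \in wdeg (size w).
Proof. by apply: mem_zspan; apply/asboolP; exists w. Qed.

Lemma letter_wdeg i : letter i \in wdeg 1.
Proof. by have := fword_wdeg [:: i]; rewrite fword_cons fword0 mulr1. Qed.

Lemma wdegM i j a b : a \in wdeg i -> b \in wdeg j -> a * b \in wdeg (i + j).
Proof.
apply: zspanM => {}a {}b /asboolP[v vi ->] /asboolP[w wj ->].
apply: mem_zspan; apply/asboolP; exists (v ++ w); first by rewrite size_cat vi wj.
by rewrite fword_cat.
Qed.

Lemma derivation_wdeg r d a :
  dx \in wdeg r.+1 -> dy \in wdeg r.+1 -> a \in wdeg d -> der a \in wdeg (d + r).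
Proof.
move=> xr yr; move: a; apply: zspan_ind => [|a b ha hb|a /asboolP[w <- ->]].
- by rewrite raddf0 rpred0.
- by rewrite raddfB rpredB.
rewrite der_fword; elim: w => [|i w IHw] /=; first exact: rpred0.
apply: rpredD; last by rewrite -[(size w).+1]add1n -addnA wdegM ?letter_wdeg.
by rewrite addSnnS addnC; apply: wdegM; [case: ifP | apply: fword_wdeg].
Qed.

Lemma derivation_euler d a :
  dx = letter 0 -> dy = letter 1 -> a \in wdeg d -> der a = a *+ d.
Proof.
move=> dxE dyE; move: a; apply: zspan_ind => [|a b ha hb|a /asboolP[w <- ->]].
- by rewrite raddf0 mul0rn.
- by rewrite raddfB /= ha hb mulrnBl.
rewrite der_fword; elim: w => [|i w IHw] /=; first by rewrite mulr0n.
rewrite IHw mulrS mulrnAr -fword_cons; congr (_ + _); rewrite fword_cons dxE dyE.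
congr (_ * _); case: i => -[|[|]] // i2 /=; congr letter; exact/val_inj.
Qed.

End WordAlgebra.

Definition letter (i : 'I_2) : freeZxy := << fmu i >>.
Definition fword (w : seq 'I_2) : freeZxy := << FMonom w >>.

Lemma fword_cons i w : fword (i :: w) = letter i * fword w.
Proof.
rewrite /letter /fword malgM_def fgmulUU mulr1; congr << _ >>.
by apply/eqP; rewrite fmP fmM fmU.
Qed.

Lemma fword0 : fword [::] = 1.
Proof. by rewrite /fword -fmoneE. Qed.

Lemma fword_ind (Q : freeZxy -> Prop) :
    Q 0 -> (forall a b, Q a -> Q b -> Q (a - b)) -> (forall w, Q (fword w)) ->
  forall a, Q a.
Proof.
move=> Q0 QB Qw a.
suff: a \in zspan (fun g => `[< exists w, g = fword w >]).
  by move: a; apply: zspan_ind => // a /asboolP[w ->].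
rewrite [a]monalgE; apply: rpred_sum => -[w] _.
have -> : << a@_(FMonom w) *g FMonom w >> = fword w *~ a@_(FMonom w).
  by rewrite /fword -raddfMz intz.
by rewrite rpredMz // mem_zspan //; apply/asboolP; exists w.
Qed.

(** The derivation with x -> dx and y -> dy. *)
Definition der (dx dy : freeZxy) : freeZxy -> freeZxy :=
  mmap intr (fun k : {fmonom 'I_2} => der_word letter fword dx dy k).
HB.instance Definition _ dx dy := GRing.Additive.copy (der dx dy)
  (mmap intr (fun k : {fmonom 'I_2} => der_word letter fword dx dy k)).

Lemma der_fword dx dy w : der dx dy (fword w) = der_word letter fword dx dy w.
Proof.
rewrite /der [in LHS]/fword mmapU; apply: etrans (mul1r _); congr (_ * _).
Qed.

Lemma derM dx dy : derivation (der dx dy).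
Proof. exact: (word_derivation fword0 fword_cons fword_ind (@der_fword dx dy)). Qed.

Lemma der_x dx dy : der dx dy var_x = dx.
Proof. exact: (derivation_letter fword0 fword_cons (@der_fword dx dy) 0). Qed.

Lemma der_y dx dy : der dx dy var_y = dy.
Proof. exact: (derivation_letter fword0 fword_cons (@der_fword dx dy) 1). Qed.

Lemma homog_wdeg d a : (a \in homog d) = (a \in wdeg fword d).
Proof.
apply/idP/idP; last first.
  move: a; apply: zspan_min => a /asboolP[w wd ->]; apply/asboolP => v.
  by rewrite /fword msuppU1 inE => /eqP->; rewrite fdegE.
move=> /asboolP ad; rewrite [a]monalgE big_seq; apply: rpred_sum => -[w] wa.
have -> : << a@_(FMonom w) *g FMonom w >> = fword w *~ a@_(FMonom w).
  by rewrite /fword -raddfMz intz.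
rewrite rpredMz // mem_zspan //; apply/asboolP; exists w => //.
by have := ad _ wa; rewrite fdegE.
Qed.

Lemma homogM i j a b : a \in homog i -> b \in homog j -> a * b \in homog (i + j).
Proof. by rewrite !homog_wdeg; apply: (wdegM fword0 fword_cons). Qed.

Lemma letter_homog i : letter i \in homog 1.
Proof. by rewrite homog_wdeg; apply: (letter_wdeg fword0 fword_cons). Qed.

Lemma der_homog dx dy r d a : dx \in homog r.+1 -> dy \in homog r.+1 ->
  a \in homog d -> der dx dy a \in homog (d + r).
Proof.
by rewrite !homog_wdeg; apply: (derivation_wdeg fword0 fword_cons (@der_fword dx dy)).
Qed.

Lemma der_euler d a : a \in homog d -> der var_x var_y a = a *+ d.
Proof.
rewrite homog_wdeg.
exact: (derivation_euler fword_cons (@der_fword var_x var_y) (erefl var_x) (erefl var_y)).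
Qed.

Section Quotient.
Variables (R : pzRingType) (g : R) (D : {additive R -> R}).
Hypotheses (DM : derivation D) (Dg : D g \in gen_ideal g).

Lemma derivation_ideal a : a \in gen_ideal g -> D a \in gen_ideal g.
Proof.
have gI : g \in gen_ideal g by apply/asboolP; exists [:: (1, 1)]; rewrite big_seq1 mul1r mulr1.
move=> /asboolP[s ->]; rewrite raddf_sum; apply: rpred_sum => p _.
rewrite !DM mulrDl rpredD ?rpredD //; last by apply/gen_idealMr/gen_idealMl.
  by apply/gen_idealMr/gen_idealMl.
by apply/gen_idealMr/gen_idealMl.
Qed.

Lemma quotient_derivation : exists2 DA : {additive ideal_quot g -> ideal_quot g},
  derivation DA & forall r, DA (ideal_proj g r) = ideal_proj g (D r).
Proof.
pose DA (a : ideal_quot g) : ideal_quot g := ideal_proj g (D (repr a)).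
have DAE r : DA (ideal_proj g r) = ideal_proj g (D r).
  apply/eqP; rewrite -subr_eq0 -raddfB ideal_proj_eq0 -raddfB derivation_ideal //.
  by rewrite -ideal_proj_eq0 raddfB subr_eq0; apply/eqP; apply: reprK.
have DAB : zmod_morphism DA.
  move=> a b; have [r <-] := ideal_proj_surj a; have [s <-] := ideal_proj_surj b.
  by rewrite -raddfB !DAE !raddfB.
exists (HB.pack_for {additive ideal_quot g -> ideal_quot g} DA
  (GRing.isZmodMorphism.Build _ _ DA DAB)); last exact: DAE.
move=> a b; have [r <-] := ideal_proj_surj a; have [s <-] := ideal_proj_surj b.
by rewrite /= -rmorphM !DAE DM rmorphD !rmorphM.
Qed.

End Quotient.

Section Final.
Variable m : nat.
Local Notation A := (Zxy_xm m).
Local Notation proj := (ideal_proj (var_x ^+ m)).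
Definition xA : A := proj var_x.
Definition yA : A := proj var_y.
Definition degA d : zmodClosed A := @Zxy_xm_deg m d.

Lemma xyA_generated : generated xA yA.
Proof.
move=> Q Q1 Qx Qy QB QM a; have [r <-] := ideal_proj_surj a.
move: r; apply: (fword_gen fword0 fword_cons fword_ind).
- by rewrite rmorph1.
- exact: Qx.
- exact: Qy.
- by move=> r s hr hs; rewrite raddfB; apply: QB.
by move=> r s hr hs; rewrite rmorphM; apply: QM.
Qed.

Lemma xA_nilpotent : xA ^+ m = 0.
Proof.
rewrite /xA -rmorphXn; apply/eqP; rewrite ideal_proj_eq0.
by apply/asboolP; exists [:: (1, 1)]; rewrite big_seq1 mul1r mulr1.
Qed.

Lemma degAP d a : a \in degA d -> exists2 r, r \in homog d & a = proj r.
Proof. by move=> /asboolP. Qed.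

Lemma proj_degA d r : r \in homog d -> proj r \in degA d.
Proof. by move=> rd; apply/asboolP; exists r. Qed.

Lemma degAM i j a b : a \in degA i -> b \in degA j -> a * b \in degA (i + j).
Proof.
move=> /degAP[r ri ->] /degAP[s sj ->]; rewrite -rmorphM.
by apply/proj_degA/homogM.
Qed.

End Final.

(** * Comparison of ranks *)
Definition free_mod (V : zmodType) (W : {pred V}) n (u : 'I_n -> V) : Prop :=
  forall c : 'I_n -> int, \sum_i u i *~ c i \in W -> forall i, c i = 0.

Section FreeTransfer.
Variables (A : pzRingType) (k : nat) (f : {additive A -> A}).
Hypothesis fM : derivation f.

(** A relation between the f (u i) is the image of the same relation between the
    u i, hence comes from a torsion relation between them. *)
Lemma free_mod_inj n (u : 'I_n -> A) :
    (forall a, a \in lcs A k -> f a \in slcs A k.+1 -> a \in slcs A k.+1) ->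
    (forall i, u i \in lcs A k) -> free_mod (lcs A k.+1) u ->
  free_mod (lcs A k.+1) (fun i => f (u i)).
Proof.
move=> finj uL fu c cW; pose s := \sum_i u i *~ c i.
have sL : s \in lcs A k by apply: rpred_sum => i _; apply: rpredMz.
have fs : f s \in slcs A k.+1.
  apply: mem_slcs; suff -> : f s = \sum_i f (u i) *~ c i by [].
  by rewrite raddf_sum; apply: eq_bigr => i _; rewrite raddfMz.
have /mem_satP[r r0] := finj s sL fs.
rewrite -sumrMnl => sW i.
have /fu/(_ i)/eqP : \sum_i u i *~ (c i * r%:Z) \in lcs A k.+1.
  by rewrite (eq_bigr (fun i => u i *~ c i *+ r)) // => j _; rewrite mulrzA -pmulrn.
by rewrite mulf_eq0 => /orP[/eqP //|]; move: r0; clear; lia.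
Qed.

(** f turns a relation between the w i into one between multiples of the u i. *)
Lemma free_mod_surj (P : {pred A}) n (u : 'I_n -> A) :
    (forall i, exists z w, [/\ z != 0 :> int, w \in lcs A k, w \in P
      & u i *~ z - f w \in lcs A k.+1]) ->
    free_mod (lcs A k.+1) u ->
  exists w : 'I_n -> A, [/\ forall i, w i \in lcs A k, forall i, w i \in P
    & free_mod (lcs A k.+1) w].
Proof.
move=> /choice[z /choice[w h]] fu; exists w; split; try by move=> i; case: (h i).
move=> c cW i.
have /fu/(_ i)/eqP : \sum_i u i *~ (z i * c i) \in lcs A k.+1.
  have -> : \sum_i u i *~ (z i * c i) =
      \sum_i (u i *~ z i - f (w i)) *~ c i + f (\sum_i w i *~ c i).
    rewrite raddf_sum -big_split; apply: eq_bigr => j _ /=.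
    by rewrite (raddfMz f) /= mulrzA -mulrzDl subrK.
  apply: rpredD; last exact: derivation_lcs.
  by apply: rpred_sum => j _; apply: rpredMz; case: (h j).
by rewrite mulf_eq0 => /orP[|/eqP //]; case: (h i) => /negPf->.
Qed.

End FreeTransfer.

Section SaturatedInjectivity.
Variables (A : pzRingType) (x y : A).
Hypothesis gen : generated x y.
Variables (e f E : {additive A -> A}).
Hypotheses (eM : derivation e) (fM : derivation f) (EM : derivation E).
Hypotheses (ex : e x = 0) (ey : e y = 1) (fx : f x = 0) (fy : f y = y ^+ 2).
Hypotheses (Ex : E x = 0) (Ey : E y = y).

Lemma f_inj_slcs k a : (1 < k)%N ->
  a \in lcs A k -> f a \in slcs A k.+1 -> a \in slcs A k.+1.
Proof.
move=> k1; have h (D : {additive A -> A}) : derivation D -> forall a, a \in slcs A k.+1 -> D a \in slcs A k.+1.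
  by move=> DM b; apply: derivation_slcs.
apply: (@f_inj A x y gen e f E eM fM EM ex ey fx fy Ex Ey (slcs A k.+1)) => //.
- by move=> b z; apply: sat_divz.
- exact: h eM.
- exact: h fM.
exact: h EM.
Qed.

End SaturatedInjectivity.

Section Rank.
Variables m k : nat.
Local Notation A := (Zxy_xm m).

Lemma pi_B_eq0 (u : zsub (lcs A k)) : (\pi_(B m k) u == 0) = (\val u \in lcs A k.+1).
Proof. by rewrite -(raddf0 (\pi_(B m k))) -Quotient.idealrBE subr0. Qed.

Lemma pi_B_sum n (u : 'I_n -> zsub (lcs A k)) c :
  (\sum_i \pi_(B m k) (u i) *~ c i == 0) = (\sum_i \val (u i) *~ c i \in lcs A k.+1).
Proof.
have -> : \sum_i \pi_(B m k) (u i) *~ c i = \pi_(B m k) (\sum_i u i *~ c i).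
  by rewrite raddf_sum; apply: eq_bigr => i _; rewrite raddfMz.
rewrite pi_B_eq0 raddf_sum; congr in_mem; apply: eq_bigr => i _.
by rewrite -[LHS]/(\val (u i *~ c i)) raddfMz.
Qed.

(** A maximal independent family of the quotient is lifted to homogeneous
    elements of L_k, which are independent modulo L_(k+1). *)
Lemma B_rank_le d d' :
    (forall n (u : 'I_n -> A), (forall i, u i \in lcs A k) -> (forall i, u i \in degA m d) ->
      free_mod (lcs A k.+1) u ->
     exists u' : 'I_n -> A, [/\ forall i, u' i \in lcs A k, forall i, u' i \in degA m d' &
      free_mod (lcs A k.+1) u']) ->
  (rank (B_deg m k d) <= rank (B_deg m k d'))%N.
Proof.
move=> H; have [[v vB fv] _] := B_deg_rank m k d; have [_] := B_deg_rank m k d'.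
have /choice[u uP] : forall i, exists u : zsub (lcs A k),
    \val u \in degA m d /\ v i = \pi_(B m k) u.
  by move=> i; have /asboolP[u ud vu] := vB i; exists u.
have [i|i|c /eqP cW|u' [u'L u'd fu']] := H _ (fun i => \val (u i)).
- exact: valP.
- by case: (uP i).
- apply: fv; rewrite (eq_bigr (fun i => \pi_(B m k) (u i) *~ c i)) => [|i _].
    by apply/eqP; rewrite pi_B_sum; apply/eqP.
  by rewrite (uP i).2.
pose s i : zsub (lcs A k) := exist _ (u' i) (u'L i).
move=> /(_ _ (fun i => \pi_(B m k) (s i))); apply.
  by move=> i; apply/asboolP; exists (s i); first exact: u'd.
move=> c /eqP; rewrite pi_B_sum => cW; apply: fu'.
exact: cW.
Qed.

End Rank.

Section Stabilization.
Variable m : nat.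
Hypothesis m0 : (0 < m)%N.
Local Notation A := (Zxy_xm m).
Local Notation x := (xA m).
Local Notation y := (yA m).
Local Notation proj := (ideal_proj (var_x ^+ m)).

(** If x goes to 0 or to x, then x^m goes to 0 or to m x^m, so that the ideal
    (x^m) is preserved. *)
Lemma derA_exists dx dy : dx = 0 \/ dx = var_x -> exists2 D : {additive A -> A},
  derivation D & forall r, D (proj r) = proj (der dx dy r).
Proof.
move=> dxE; apply: (quotient_derivation (derM dx dy)).
case: dxE => ->; first by rewrite (derivationX0 (derM 0 dy) _ (der_x 0 dy)); exact: rpred0.
have xI : var_x ^+ m \in gen_ideal (var_x ^+ m).
  by apply/asboolP; exists [:: (1, 1)]; rewrite big_seq1 mul1r mulr1.
rewrite [X in X \in _](_ : _ = var_x ^+ m *+ m); first exact: rpredMn.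
exact: (derivationX_fix (derM var_x dy) _ (der_x var_x dy)).
Qed.

Lemma raiseA_exists : exists2 f : {additive A -> A}, derivation f &
  [/\ f x = 0, f y = y ^+ 2 & forall d a, a \in degA m d -> f a \in degA m d.+1].
Proof.
have [f fM fE] := @derA_exists 0 (var_y ^+ 2) (or_introl erefl).
exists f => //; split=> [||d a /degAP[r rd ->]].
- by rewrite fE der_x raddf0.
- by rewrite fE der_y rmorphXn.
rewrite fE -[d.+1]addn1; apply/proj_degA/der_homog => //; first exact: rpred0.
by rewrite expr2; apply: (@homogM 1 1); apply: (letter_homog 1).
Qed.

Lemma eulerA_exists : exists2 Et : {additive A -> A}, derivation Et &
  forall d a, a \in degA m d -> Et a = a *+ d.
Proof.
have [Et EtM EtE] := @derA_exists var_x var_y (or_intror erefl).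
exists Et => // d a /degAP[r rd ->].
by rewrite EtE (der_euler rd) raddfMn.
Qed.

Variable k : nat.
Hypothesis k1 : (1 < k)%N.

Lemma rank_mono d : (rank (B_deg m k d) <= rank (B_deg m k d.+1))%N.
Proof.
have [f fM [fx fy fdeg]] := raiseA_exists.
have [e eM eE] := @derA_exists 0 1 (or_introl erefl).
have [E EM EE] := @derA_exists 0 var_y (or_introl erefl).
have ex : e x = 0 by rewrite eE der_x raddf0.
have ey : e y = 1 by rewrite eE der_y rmorph1.
have Ex : E x = 0 by rewrite EE der_x raddf0.
have Ey : E y = y by rewrite EE der_y.
apply: B_rank_le => n u uL ud fu; exists (fun i => f (u i)); split.
- by move=> i; exact: (derivation_lcs fM (uL i)).
- by move=> i; apply: fdeg.
apply: (free_mod_inj _ uL fu) => a.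
exact: (f_inj_slcs (@xyA_generated m) eM fM EM ex ey fx fy Ex Ey k1).
Qed.

Lemma rank_anti d : (k = 2 -> m <= d)%N -> (2 * k + m <= d + 5)%N ->
  (rank (B_deg m k d.+1) <= rank (B_deg m k d))%N.
Proof.
move=> d1 dn; have [f fM [fx fy fdeg]] := raiseA_exists; have [Et EtM EtE] := eulerA_exists.
have deg1 : 1 \in degA m 0.
  apply/asboolP; exists 1 => //; rewrite -fword0 homog_wdeg.
  exact: (fword_wdeg fword [::]).
have degx : x \in degA m 1 by apply/proj_degA/(letter_homog 0).
have degy : y \in degA m 1 by apply/proj_degA/(letter_homog 1).
apply: B_rank_le => n u uL ud fu; apply: (free_mod_surj fM _ fu) => i.
case: k k1 d1 dn uL {fu} => [|k'] // k1' d1 dn uL.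
apply: (f_surj (@xyA_generated m) deg1 degx degy (@degAM m) fM EtM fx fy EtE m0 (xA_nilpotent m)
  (n := k') (d := d) k1' _ _ (uL i) (ud i)).
  by move=> k'1; apply: d1; rewrite k'1.
by move: dn; clear; lia.
Qed.

End Stabilization.

Local Close Scope ring_scope.
Unset Implicit Arguments.

Theorem theorem4p1 (m k : nat) (hm : 1 <= m) (hk : 2 <= k) :
  exists l : nat,
    (forall j : nat, l <= j -> rank (B_deg m k l) = rank (B_deg m k j)) /\
    (k = 2 -> l <= m) /\
    (3 <= k -> l <= 2 * k + m - 5).
Proof.
exists (if k == 2 then m else 2 * k + m - 5); split; last first.
  by split=> [->|k3] //; case: eqP => // k2; rewrite k2 in k3.
elim=> [|j IHj]; first by rewrite leqn0 => /eqP ->.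
rewrite leq_eqVlt => /predU1P[-> //|lj]; rewrite IHj //.
apply/eqP; rewrite eqn_leq rank_mono // rank_anti //; move: hk lj; clear.
  by case: eqP; lia.
by case: eqP; lia.
Qed.
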